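(* Let $k$ be a field, $Q=(Q_0,Q_1)$ a finite quiver, $I$ an admissible ideal of the path algebra $kQ$, and $\Lambda = kQ/I$. Let $x \in Q_0\cup Q_1$ and suppose that $I$ is generated by relations not involving $x$. Let $J$ be the two-sided ideal of $\Lambda$ generated by (the class of) $x$. Then $\mathrm{findim}\,\Lambda \le 2\,\mathrm{findim}\,(\Lambda/J) + 3 \le 2\,\mathrm{findim}\,\Lambda + 3$.
   Context: A vertex $x \in Q_0$ is identified with the corresponding trivial path (idempotent) of $kQ$, and an arrow with the corresponding path of length one. An element of $kQ$ is uniform if it is a linear combination of parallel paths (same source and same target). ''$I$ is generated by relations not involving $x$'' means that there is a finite set $\{r_1,\dots,r_t\}$ of uniform elements of $kQ$ generating $I$ as a two-sided ideal such that, for each $i$, no path occurring with nonzero coefficient in $r_i$ factors through $x$ (i.e. none has the form $p x q$ with $p,q$ paths). For an Artin algebra $A$, $\mathrm{findim}\,A = \sup\{\mathrm{pd}_A M \mid M \text{ a finitely generated left } A\text{-module with } \mathrm{pd}_A M<\infty\}$ (possibly $\infty$), where $\mathrm{pd}$ denotes projective dimension. *)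

(* Defs.v *)
From HB Require Import structures.
From mathcomp Require Import all_boot all_order all_algebra.
From mathcomp Require Import finmap.
From mathcomp.multinomials Require Import monalg.
From mathcomp Require Import boolp classical_sets constructive_ereal.

Set Implicit Arguments.
Unset Strict Implicit.
Unset Printing Implicit Defensive.

Import Order.TTheory GRing.Theory Num.Theory.
Local Open Scope classical_set_scope.
Local Open Scope ring_scope.
Local Open Scope quotient_scope.

(* Every ring structure below is a [pzRingType], i.e. the zero ring is allowed:
   Lambda / J may vanish, and kQ does when Q has no vertex. *)

Section Ideals.
Variable R : pzRingType.

Definition two_sided_ideal (I : set R) : Prop :=
  [/\ I 0,
      forall x y, I x -> I y -> I (x + y),
      forall a x, I x -> I (a * x) &
      forall a x, I x -> I (x * a)].

Record ideal := Ideal {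
  ideal_set :> set R;
  idealP : two_sided_ideal ideal_set }.

Lemma two_sided_ideal_smallest (S : set R) :
  two_sided_ideal (smallest two_sided_ideal S).
Proof.
split=> [I [[]]//|x y Sx Sy I IS|a x Sx I IS|a x Sx I IS];
  by case: (IS) => -[? D ? ?] _; [apply: D; [exact: Sx|exact: Sy] |..]
  || (case: (IS) => -[_ _ L M] _; first [apply: L; exact: Sx
                                        | apply: M; exact: Sx]).
Qed.

Definition ideal_gen (S : set R) : ideal :=
  Ideal (two_sided_ideal_smallest S).

Lemma two_sided_ideal_setT : two_sided_ideal [set: R].
Proof. by []. Qed.

Definition ideal_prod_set (I J : set R) : set R :=
  [set x | exists n (a b : 'I_n -> R),
     [/\ forall i, I (a i), forall i, J (b i) & x = \sum_i a i * b i]].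

Lemma two_sided_ideal_prod (I J : ideal) :
  two_sided_ideal (ideal_prod_set I J).
Proof.
have [_ _ IL _] := idealP I; have [_ _ _ JR] := idealP J.
split=> [|x y|c x|c x].
- by exists 0%N, (fun=> 0), (fun=> 0); split=> [[]|[]|] //; rewrite big_ord0.
- move=> [n [a [b [Ia Jb ->]]]] [m [a' [b' [Ia' Jb' ->]]]].
  exists (n + m)%N,
    (fun i => match split i with inl j => a j | inr j => a' j end),
    (fun i => match split i with inl j => b j | inr j => b' j end).
  split=> [i|i|]; try by case: (split i).
  rewrite big_split_ord /=; congr (_ + _); apply: eq_bigr => i _.
    by rewrite (unsplitK (inl i : 'I_n + 'I_m)).
  by rewrite (unsplitK (inr i : 'I_n + 'I_m)).
- move=> [n [a [b [Ia Jb ->]]]]; exists n, (fun i => c * a i), b.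
  split=> // [i|]; first exact: IL.
  by rewrite mulr_sumr; apply: eq_bigr => i _; rewrite mulrA.
- move=> [n [a [b [Ia Jb ->]]]]; exists n, a, (fun i => b i * c).
  split=> // [i|]; first exact: JR.
  by rewrite mulr_suml; apply: eq_bigr => i _; rewrite mulrA.
Qed.

Definition ideal_prod (I J : ideal) : ideal := Ideal (two_sided_ideal_prod I J).

Definition ideal_exp (I : ideal) (n : nat) : ideal :=
  iter n (ideal_prod I) (Ideal two_sided_ideal_setT).

End Ideals.

(* [ring_quotient] only provides ring quotients of commutative rings. *)
Section RingQuotient.
Variables (R : pzRingType) (I : ideal R).

Definition ideal_mem : {pred R} := fun x => `[< ideal_set I x >].

Lemma ideal_mem_zmod_closed : zmod_closed ideal_mem.
Proof.
have [I0 ID IL _] := idealP I; split; first exact/asboolP.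
move=> x y /asboolP Ix /asboolP Iy; apply/asboolP; apply: ID => //.
by rewrite -mulN1r; apply: IL.
Qed.
HB.instance Definition _ :=
  GRing.isZmodClosed.Build R ideal_mem ideal_mem_zmod_closed.

Definition ring_quot : Type := Quotient.quot ideal_mem.
HB.instance Definition _ := GRing.Zmodule.on ring_quot.
HB.instance Definition _ := EqQuotient.on ring_quot.

Definition ring_pi : R -> ring_quot := \pi_ring_quot.

Lemma ring_piE x y : ring_pi x = ring_pi y <-> ideal_set I (x - y).
Proof.
have E : (ring_pi x == ring_pi y) = (x - y \in ideal_mem).
  by rewrite (Quotient.idealrBE ideal_mem).
by split=> [/eqP|h]; [rewrite E => /asboolP|apply/eqP; rewrite E; apply/asboolP].
Qed.

Lemma ring_pi_surj y : exists x, ring_pi x = y.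
Proof. by exists (repr y); rewrite /ring_pi reprK. Qed.

Lemma ring_pi_is_zmod_morphism : zmod_morphism ring_pi.
Proof. by move=> x y; exact: (raddfB (\pi_(Quotient.quot ideal_mem))). Qed.
HB.instance Definition _ :=
  GRing.isZmodMorphism.Build R ring_quot ring_pi ring_pi_is_zmod_morphism.

Definition ring_quot_one : ring_quot := ring_pi 1.
Definition ring_quot_mul (x y : ring_quot) : ring_quot :=
  ring_pi (repr x * repr y).

Lemma ring_pi_mul x y : ring_quot_mul (ring_pi x) (ring_pi y) = ring_pi (x * y).
Proof.
have [_ ID IL IR] := idealP I; apply/ring_piE.
have h z : ideal_set I (repr (ring_pi z) - z) by apply/ring_piE; rewrite /ring_pi reprK.
rewrite -[X in X - _](subrK (repr (ring_pi x) * y)) -mulrBr -addrA -mulrBl.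
by apply: ID; [apply: IL|apply: IR].
Qed.

Lemma ring_quot_mulA : associative ring_quot_mul.
Proof.
move=> x y z; have [[a <-] [b <-] [c <-]] :=
  And3 (ring_pi_surj x) (ring_pi_surj y) (ring_pi_surj z).
by rewrite !ring_pi_mul mulrA.
Qed.
Lemma ring_quot_mul1r : left_id ring_quot_one ring_quot_mul.
Proof. by move=> x; have [a <-] := ring_pi_surj x; rewrite ring_pi_mul mul1r. Qed.
Lemma ring_quot_mulr1 : right_id ring_quot_one ring_quot_mul.
Proof. by move=> x; have [a <-] := ring_pi_surj x; rewrite ring_pi_mul mulr1. Qed.
Lemma ring_quot_mulDl : left_distributive ring_quot_mul +%R.
Proof.
move=> x y z; have [[a <-] [b <-] [c <-]] :=
  And3 (ring_pi_surj x) (ring_pi_surj y) (ring_pi_surj z).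
by rewrite -raddfD !ring_pi_mul mulrDl raddfD.
Qed.
Lemma ring_quot_mulDr : right_distributive ring_quot_mul +%R.
Proof.
move=> x y z; have [[a <-] [b <-] [c <-]] :=
  And3 (ring_pi_surj x) (ring_pi_surj y) (ring_pi_surj z).
by rewrite -raddfD !ring_pi_mul mulrDr raddfD.
Qed.
HB.instance Definition _ := GRing.Zmodule_isPzRing.Build ring_quot
  ring_quot_mulA ring_quot_mul1r ring_quot_mulr1 ring_quot_mulDl ring_quot_mulDr.

Lemma ring_pi_is_monoid_morphism : monoid_morphism ring_pi.
Proof. by split=> // x y; rewrite -ring_pi_mul. Qed.
HB.instance Definition _ :=
  GRing.isMonoidMorphism.Build R ring_quot ring_pi ring_pi_is_monoid_morphism.

End RingQuotient.

Record quiver := Quiver {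
  vertex : finType;
  arrow : finType;
  src : arrow -> vertex;
  tgt : arrow -> vertex }.

Section Paths.
Variable Q : quiver.

Fixpoint walk (u : vertex Q) (s : seq (arrow Q)) : bool :=
  if s is a :: s' then (src a == u) && walk (tgt a) s' else true.

Definition walk_end (u : vertex Q) (s : seq (arrow Q)) : vertex Q :=
  last u (map (@tgt Q) s).

(* A path is a start vertex together with the arrows traversed from it, in the
   order of traversal; the trivial path at v is (v, [::]). *)
Record qpath := QPath {
  qpath_val : vertex Q * seq (arrow Q);
  _ : walk qpath_val.1 qpath_val.2 }.

HB.instance Definition _ := [isSub for qpath_val].
HB.instance Definition _ := [Choice of qpath by <:].

Definition path_src (p : qpath) : vertex Q := (val p).1.
Definition path_arrows (p : qpath) : seq (arrow Q) := (val p).2.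
Definition path_tgt (p : qpath) : vertex Q :=
  walk_end (path_src p) (path_arrows p).

Definition trivial_path (v : vertex Q) : qpath := @QPath (v, [::]) isT.

Lemma walk_arrow a : walk (src a) [:: a].
Proof. by rewrite /= eqxx. Qed.
Definition arrow_path (a : arrow Q) : qpath :=
  @QPath (src a, [:: a]) (walk_arrow a).

Lemma walk_cat u s t : walk u (s ++ t) = walk u s && walk (walk_end u s) t.
Proof. by elim: s u => //= a s IHs u; rewrite IHs andbA. Qed.

Lemma walk_end_cat u s t : walk_end u (s ++ t) = walk_end (walk_end u s) t.
Proof. by rewrite /walk_end map_cat last_cat. Qed.

(* p followed by q *)
Definition path_comp (p q : qpath) : option qpath :=
  if path_tgt p == path_src q
  then insub (path_src p, path_arrows p ++ path_arrows q) else None.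

Lemma path_compP p q r :
  path_comp p q = Some r <->
  [/\ path_tgt p = path_src q, path_src r = path_src p &
      path_arrows r = path_arrows p ++ path_arrows q].
Proof.
rewrite /path_comp; split=> [|[pq rp rpq]].
  case: eqP => // pq; case: insubP => // r' _ E [<-].
  by rewrite /path_src /path_arrows E.
rewrite pq eqxx -rp -rpq /path_src /path_arrows -surjective_pairing.
exact: valK.
Qed.

Lemma path_comp_ex p q : path_tgt p = path_src q ->
  exists r, path_comp p q = Some r.
Proof.
move=> pq; rewrite /path_comp pq eqxx; case: insubP => [r _ _|]; first by exists r.
case: p q pq => -[u s] /= ws [[v t] /= wt] pq.
by rewrite walk_cat ws /= -/(walk_end u s) [walk_end u s]pq wt.
Qed.

Lemma path_comp_None p q : path_tgt p <> path_src q -> path_comp p q = None.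
Proof. by rewrite /path_comp => /eqP/negbTE->. Qed.

Lemma path_inj p q :
  path_src p = path_src q -> path_arrows p = path_arrows q -> p = q.
Proof.
move=> H1 H2; apply: val_inj; rewrite [val p]surjective_pairing.
by rewrite [val q]surjective_pairing -!/(path_src _) -!/(path_arrows _) H1 H2.
Qed.

Lemma path_comp_tgt p q r : path_comp p q = Some r -> path_tgt r = path_tgt q.
Proof.
by case/path_compP=> pq rp rpq; rewrite /path_tgt rp rpq walk_end_cat -pq.
Qed.

Lemma path_compA p q r :
  obind (path_comp p) (path_comp q r) =
  obind (fun pq => path_comp pq r) (path_comp p q).
Proof.
case: (eqVneq (path_tgt q) (path_src r)) => [qr|/eqP qr]; last first.
  rewrite (path_comp_None qr) /=.
  case E: (path_comp p q) => [pq|] //=.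
  by rewrite path_comp_None // (path_comp_tgt E).
have [s Es] := path_comp_ex qr; rewrite Es /=.
have [_ s1 s2] := (path_compP _ _ _).1 Es.
case: (eqVneq (path_tgt p) (path_src q)) => [pq|/eqP pq]; last first.
  by rewrite (path_comp_None pq) path_comp_None // s1.
have [t Et] := path_comp_ex pq; rewrite Et /=.
have [_ t1 t2] := (path_compP _ _ _).1 Et.
have [z Ez] := path_comp_ex (etrans pq (esym s1)); rewrite Ez.
have [_ z1 z2] := (path_compP _ _ _).1 Ez.
apply/esym/path_compP; split; first by rewrite (path_comp_tgt Et).
  by rewrite z1 t1.
by rewrite z2 s2 t2 catA.
Qed.

End Paths.

Definition path_algebra (k : fieldType) (Q : quiver) : Type :=
  {malg k[qpath Q]}.

Section PathAlgebra.
Variables (k : fieldType) (Q : quiver).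
Local Notation kQ := (path_algebra k Q).
Implicit Types (f g h : kQ) (p q r : qpath Q) (c : k).

HB.instance Definition _ := GRing.Lmodule.on kQ.

Definition path_elt p : kQ := << p >>.

Definition path_elt_comp p q : kQ :=
  if path_comp p q is Some r then path_elt r else 0.

Definition path_mul f g : kQ :=
  \sum_(p <- msupp f) \sum_(q <- msupp g) (f@_p * g@_q) *: path_elt_comp p q.

Definition path_one : kQ := \sum_(v : vertex Q) path_elt (trivial_path v).

Lemma path_eltE f : f = \sum_(p <- msupp f) f@_p *: path_elt p.
Proof.
rewrite [LHS]monalgE; apply: eq_bigr => p _; apply/malgP => q.
by rewrite mcoeffZ !mcoeffU mulr_natr.
Qed.

Lemma path_mulw (d1 d2 : {fset qpath Q}) f g :
  fsubset (msupp f) d1 -> fsubset (msupp g) d2 ->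
  path_mul f g =
  \sum_(p <- d1) \sum_(q <- d2) (f@_p * g@_q) *: path_elt_comp p q.
Proof.
move=> l1 l2; rewrite /path_mul (big_fset_incl _ l1) /=.
  apply: eq_bigr => p _; apply: big_fset_incl => // q _ /mcoeff_outdom ->.
  by rewrite mulr0 scale0r.
move=> p _ /mcoeff_outdom fp; rewrite big1 // => q _.
by rewrite fp mul0r scale0r.
Qed.

Lemma path_mulDl : left_distributive path_mul +%R.
Proof.
move=> f g h; set d := fsetU (msupp f) (msupp g).
rewrite (@path_mulw d (msupp h) f) ?fsubsetUl //.
rewrite (@path_mulw d (msupp h) g) ?fsubsetUr //.
rewrite (@path_mulw d (msupp h) (f + g)) ?msuppD_le //.
rewrite -big_split /=; apply: eq_bigr => p _.
rewrite -big_split /=; apply: eq_bigr => q _.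
by rewrite mcoeffD mulrDl scalerDl.
Qed.

Lemma path_mulDr : right_distributive path_mul +%R.
Proof.
move=> h f g; set d := fsetU (msupp f) (msupp g).
rewrite (@path_mulw (msupp h) d h f) ?fsubsetUl //.
rewrite (@path_mulw (msupp h) d h g) ?fsubsetUr //.
rewrite (@path_mulw (msupp h) d h (f + g)) ?msuppD_le //.
rewrite -big_split /=; apply: eq_bigr => p _.
rewrite -big_split /=; apply: eq_bigr => q _.
by rewrite mcoeffD mulrDr scalerDl.
Qed.

Lemma path_mulZl c f g : path_mul (c *: f) g = c *: path_mul f g.
Proof.
rewrite (@path_mulw (msupp f) (msupp g)) ?msuppZ_le // scaler_sumr.
apply: eq_bigr => p _; rewrite scaler_sumr; apply: eq_bigr => q _.
by rewrite mcoeffZ scalerA mulrA.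
Qed.

Lemma path_mulZr c f g : path_mul f (c *: g) = c *: path_mul f g.
Proof.
rewrite (@path_mulw (msupp f) (msupp g)) ?msuppZ_le // scaler_sumr.
apply: eq_bigr => p _; rewrite scaler_sumr; apply: eq_bigr => q _.
by rewrite mcoeffZ scalerA mulrCA.
Qed.

Lemma path_mul0l f : path_mul 0 f = 0.
Proof. by rewrite -[X in path_mul X](scale0r 0) path_mulZl scale0r. Qed.
Lemma path_mul0r f : path_mul f 0 = 0.
Proof. by rewrite -[X in path_mul _ X](scale0r 0) path_mulZr scale0r. Qed.

Lemma path_mul_suml I (s : seq I) P (F : I -> kQ) g :
  path_mul (\sum_(i <- s | P i) F i) g = \sum_(i <- s | P i) path_mul (F i) g.
Proof.
exact: (big_morph (path_mul^~ g) (fun x y => path_mulDl x y g) (path_mul0l g)).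
Qed.
Lemma path_mul_sumr I (s : seq I) P (F : I -> kQ) g :
  path_mul g (\sum_(i <- s | P i) F i) = \sum_(i <- s | P i) path_mul g (F i).
Proof. exact: (big_morph (path_mul g) (path_mulDr g) (path_mul0r g)). Qed.

Lemma path_mul_elt p q : path_mul (path_elt p) (path_elt q) = path_elt_comp p q.
Proof.
rewrite (@path_mulw (fset1 p) (fset1 q)) ?msuppU_le //.
by rewrite !big_seq_fset1 !mcoeffUU mulr1 scale1r.
Qed.

Lemma path_mul_elt_A p q r :
  path_mul (path_elt p) (path_mul (path_elt q) (path_elt r)) =
  path_mul (path_mul (path_elt p) (path_elt q)) (path_elt r).
Proof.
rewrite !path_mul_elt /path_elt_comp; have := path_compA p q r.
case: (path_comp q r) (path_comp p q) => [s|] [t|] /=;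
  rewrite ?path_mul0l ?path_mul0r ?path_mul_elt /path_elt_comp //.
- by move=> ->.
- by move=> ->.
- by move=> <-.
Qed.

Lemma path_algebra_ind (P : kQ -> Prop) :
  P 0 -> (forall f g, P f -> P g -> P (f + g)) ->
  (forall c f, P f -> P (c *: f)) -> (forall p, P (path_elt p)) ->
  forall f, P f.
Proof.
move=> P0 PD PZ Pe f; rewrite (path_eltE f).
by elim/big_ind: _ => // p _; apply: PZ.
Qed.

Lemma path_mulA : associative path_mul.
Proof.
move=> f g h; elim/path_algebra_ind: f => [|f f' E E'|c f E|p].
- by rewrite !path_mul0l.
- by rewrite !path_mulDl E E'.
- by rewrite !path_mulZl E.
elim/path_algebra_ind: g => [|g g' E E'|c g E|q].
- by rewrite path_mul0l !path_mul0r path_mul0l.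
- by rewrite path_mulDl !path_mulDr path_mulDl E E'.
- by rewrite path_mulZl !path_mulZr path_mulZl E.
elim/path_algebra_ind: h => [|h h' E E'|c h E|r].
- by rewrite !path_mul0r.
- by rewrite !path_mulDr E E'.
- by rewrite !path_mulZr E.
exact: path_mul_elt_A.
Qed.

Lemma path_mul1 : left_id path_one path_mul.
Proof.
move=> f; rewrite {1}(path_eltE f) [RHS]path_eltE path_mul_sumr.
apply: eq_bigr => p _; rewrite path_mulZr; congr (_ *: _).
rewrite path_mul_suml (bigD1 (path_src p)) //= big1 ?addr0 => [|v vp].
  rewrite path_mul_elt /path_elt_comp.
  by have -> : path_comp (trivial_path (path_src p)) p = Some p by apply/path_compP.
by rewrite path_mul_elt /path_elt_comp path_comp_None //; exact/eqP.
Qed.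

Lemma path_mulr1 : right_id path_one path_mul.
Proof.
move=> f; rewrite {1}(path_eltE f) [RHS]path_eltE path_mul_suml.
apply: eq_bigr => p _; rewrite path_mulZl; congr (_ *: _).
rewrite path_mul_sumr (bigD1 (path_tgt p)) //= big1 ?addr0 => [|v vp].
  rewrite path_mul_elt /path_elt_comp.
  have -> // : path_comp p (trivial_path (path_tgt p)) = Some p.
  by apply/path_compP; rewrite cats0.
by rewrite path_mul_elt /path_elt_comp path_comp_None //; apply/nesym/eqP.
Qed.

HB.instance Definition _ := GRing.Zmodule_isPzRing.Build kQ
  path_mulA path_mul1 path_mulr1 path_mulDl path_mulDr.
(* [algType] requires 1 != 0, so the k-algebra structure of kQ is recorded by
   its zmodule, ring and k-module instances and these two compatibilities. *)
Lemma path_algebra_scaleAl c f g : c *: (f * g) = (c *: f) * g.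
Proof. by rewrite [RHS]path_mulZl. Qed.
Lemma path_algebra_scaleAr c f g : c *: (f * g) = f * (c *: g).
Proof. by rewrite [RHS]path_mulZr. Qed.

Definition quiver_elt (x : vertex Q + arrow Q) : kQ :=
  match x with
  | inl v => path_elt (trivial_path v)
  | inr a => path_elt (arrow_path a)
  end.

Definition arrow_ideal : ideal kQ :=
  ideal_gen [set quiver_elt (inr a) | a in [set: arrow Q]].

Definition admissible (I : ideal kQ) : Prop :=
  (exists2 m, (2 <= m)%N & (ideal_exp arrow_ideal m : set kQ) `<=` I) /\
  (I : set kQ) `<=` ideal_exp arrow_ideal 2.

Definition uniform f : Prop :=
  forall p q, p \in msupp f -> q \in msupp f ->
    path_src p = path_src q /\ path_tgt p = path_tgt q.

Definition factors_through (x : vertex Q + arrow Q) p : Prop :=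
  exists q1 q2, path_elt p = path_elt q1 * quiver_elt x * path_elt q2.

Definition generated_by_relations_not_involving
    (x : vertex Q + arrow Q) (I : ideal kQ) : Prop :=
  exists rs : seq kQ,
    [/\ forall f, f \in rs -> uniform f,
        forall f p, f \in rs -> p \in msupp f -> ~ factors_through x p &
        (I : set kQ) = ideal_gen [set` rs]].

End PathAlgebra.

Section Homological.
Variable A : pzRingType.

Definition finitely_generated (M : lmodType A) : Prop :=
  exists n (g : 'I_n -> M), forall m, exists c : 'I_n -> A, m = \sum_i c i *: g i.

Definition projective (P : lmodType A) : Prop :=
  forall (M N : lmodType A) (g : {linear M -> N}) (f : {linear P -> N}),
    (forall y, exists x, g x = y) ->
    exists h : {linear P -> M}, forall x, g (h x) = f x.

(* 0 -> P_n -> ... -> P_1 -> P_0 -> M -> 0, continued by zero modules. *)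
Definition has_projective_resolution (M : lmodType A) (n : nat) : Prop :=
  exists (P : nat -> lmodType A) (d : forall i, {linear P i.+1 -> P i})
         (eps : {linear P 0%N -> M}),
    [/\ forall i, projective (P i),
        forall i, (n < i)%N -> forall z : P i, z = 0,
        forall y, exists x, eps x = y,
        forall x, eps x = 0 <-> exists y, d 0%N y = x &
        forall i x, d i x = 0 <-> exists y, d i.+1 y = x].

(* Lengths of resolutions are natural numbers, so by this convention
   the zero module has projective dimension 0. *)
Definition pd (M : lmodType A) : \bar int :=
  infimum +oo%E [set n%:Z%:E | n in has_projective_resolution M].

Definition findim : \bar int :=
  supremum -oo%E
    [set e | exists M : lmodType A,
       [/\ finitely_generated M, (pd M < +oo)%E & e = pd M]].

End Homological.

(* Main.v *)
Require Import Defs.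
From HB Require Import structures.
From mathcomp Require Import all_boot all_order all_algebra.
From mathcomp Require Import finmap.
From mathcomp Require Import zify.
From mathcomp.multinomials Require Import monalg.
From mathcomp Require Import boolp classical_sets constructive_ereal.

Set Implicit Arguments.
Unset Strict Implicit.
Unset Printing Implicit Defensive.

Import Order.TTheory GRing.Theory Num.Theory.

(** Write B for the quotient of Lambda by J, and let E consist of the arrows that
    disappear with x: x itself if x is an arrow, the arrows that start or end
    at x if x is a vertex. No arrow of E occurs in a relation. Hence, on a
    Lambda-module M, the arrows of E may be given new actions, by arbitrary
    k-linear maps e_(tgt a) M -> e_(src a) M, and all relations still hold
    ([twist]).

    Letting the arrows of E act by zero turns M into [cut M], and the elements
    of [cut M] killed by J form a B-module [reduct M]. This functor is exact
    ([reduct_short_exact]), and it undoes inflation along Lambda -> B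
    ([reduct_inflate]). The proof compares projective dimensions along it.

    - [reduct_projective]: [reduct P] is projective if P is. Given a surjection
      M -> N and a map [reduct P -> N] of B-modules, the pullback of M and
      [cut P] over N maps onto P; linear sections over k provide actions of the
      arrows of E on the pullback for which this map onto P is Lambda-linear.
      It then splits because P is projective, and the splitting yields the
      required map [reduct P -> M].

    - [kernel_projective]: if [reduct K] is projective, then the kernel of any
      surjection F -> K with F projective is projective. Indeed, away from the
      arrows of E every extension of K by a module Z splits, so the extension
      is described by linear maps e_(tgt a) K -> e_(src a) Z, one for each a in
      E, and these lift freely along any surjection Y -> Z. In other words the
      first extension functor of K is right exact.

    Consequently pd (reduct M) <= pd M <= pd (reduct M) + 1: the first bound
    applies the functor to a resolution, the second takes syzygies of M until
    their reduct is projective, which is a matter of Schanuel's lemma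
    ([pd_le_syzygy]). As Lambda is finite-dimensional, [reduct M] is finitely
    generated when M is, so findim Lambda <= findim B + 1. Conversely, for a
    finitely generated B-module X of finite projective dimension, the inflation
    of X has finite projective dimension over Lambda, at least that of
    X = reduct (inflate X), so findim B <= findim Lambda. Both inequalities of
    the theorem follow since findim B is nonnegative. *)

Local Open Scope classical_set_scope.
Local Open Scope ring_scope.

(** * Submodules and kernels *)

Definition linear_of (A : pzRingType) (U V : lmodType A) (f : U -> V)
    (fl : linear f) : {linear U -> V} :=
  HB.pack f (GRing.isLinear.Build A U V *:%R f fl).

Section Submodules.
Variables (A : pzRingType) (V : lmodType A).

Definition is_submodule (S : set V) : Prop :=
  S 0 /\ forall a u v, S u -> S v -> S (a *: u + v).

Record submodule := Submodule {
  submodule_set :> set V;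
  submoduleP : is_submodule submodule_set }.

Variable S : submodule.

Definition submodule_mem : {pred V} := fun v => `[< submodule_set S v >].

Lemma submodule_mem_closed : subsemimod_closed submodule_mem.
Proof.
have [S0 SD] := submoduleP S.
split; first split.
- exact/asboolP.
- by move=> u v /asboolP Su /asboolP Sv; apply/asboolP; rewrite -[u]scale1r; apply: SD.
- by move=> a u /asboolP Su; apply/asboolP; rewrite -[a *: u]addr0; apply: SD.
Qed.
HB.instance Definition _ :=
  GRing.isSubmodClosed.Build A V submodule_mem submodule_mem_closed.

Record submod := SubMod { submod_val : V; _ : submod_val \in submodule_mem }.
HB.instance Definition _ := [isSub for submod_val].
HB.instance Definition _ := [Choice of submod by <:].
HB.instance Definition _ := [SubChoice_isSubLmodule of submod by <:].

Lemma submodP (u : submod) : submodule_set S (val u).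
Proof. exact/asboolP/(valP u). Qed.

Definition mksub v (Sv : submodule_set S v) : submod :=
  SubMod (introT (asboolP _) Sv).

End Submodules.

Section Kernel.
Variables (A : pzRingType) (U V : lmodType A) (f : {linear U -> V}).

Lemma ker_is_submodule : is_submodule [set u | f u = 0].
Proof.
split=> [|a u v /= fu fv]; first exact: linear0.
by rewrite linearP fu fv scaler0 addr0.
Qed.

Definition kernel : lmodType A := submod (Submodule ker_is_submodule).

Lemma kernelP (u : kernel) : f (val u) = 0.
Proof. exact: submodP u. Qed.

Definition mkker u (fu : f u = 0) : kernel :=
  @mksub A U (Submodule ker_is_submodule) u fu.

Definition ker_incl : {linear kernel -> U} := val.

End Kernel.

(** * Projective dimension through syzygies *)

Section ShortExact.
Variable A : pzRingType.
Implicit Types K P M X Y : lmodType A.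

Definition short_exact K P M (i : {linear K -> P}) (q : {linear P -> M}) :=
  [/\ injective i, forall y, exists x, q x = y &
      forall y, q y = 0 <-> exists x, i x = y].

Lemma short_exact_ker P M (q : {linear P -> M}) :
  (forall y, exists x, q x = y) -> short_exact (ker_incl q) q.
Proof.
move=> qs; split=> //; first exact: val_inj.
move=> y; split=> [qy|[x <-]]; first by exists (mkker qy).
exact: kernelP.
Qed.

(** The bound pd M <= n, by recursion on syzygies: this form is preserved by
    the manipulations of short exact sequences below without handling a whole
    resolution at a time. *)
Fixpoint pd_le n M : Prop :=
  if n is m.+1 then
    exists P K (i : {linear K -> P}) (q : {linear P -> M}),
      [/\ projective P, short_exact i q & pd_le m K]
  else projective M.

Lemma projective_retract X Y (i : {linear X -> Y}) (r : {linear Y -> X}) :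
  (forall x, r (i x) = x) -> projective Y -> projective X.
Proof.
move=> ri pY M N g f gs; have [h gh] := pY M N g (f \o r) gs.
by exists (h \o i) => x /=; rewrite gh /= ri.
Qed.

Lemma projective_section P M (q : {linear M -> P}) :
  projective P -> (forall y, exists x, q x = y) ->
  exists s : {linear P -> M}, forall y, q (s y) = y.
Proof. by move=> pP qs; exact: (pP M P q idfun). Qed.

Lemma projective_prod P Q :
  projective P -> projective Q -> projective (P * Q)%type.
Proof.
move=> pP pQ M N g f gs.
have l1 : linear (fun p : P => f (p, 0)).
  move=> a u v; rewrite -linearP; congr (f _).
  by congr pair; rewrite /= scaler0 addr0.
have l2 : linear (fun p : Q => f (0, p)).
  move=> a u v; rewrite -linearP; congr (f _).
  by congr pair; rewrite /= scaler0 addr0.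
have [h1 H1] := pP _ _ g (linear_of l1) gs.
have [h2 H2] := pQ _ _ g (linear_of l2) gs.
have l3 : linear (fun p : (P * Q)%type => h1 p.1 + h2 p.2).
  by move=> a u v; rewrite !linearP scalerDr addrACA.
exists (linear_of l3) => -[p q] /=; rewrite linearD H1 H2 /= -linearD.
by congr (f _); congr pair; rewrite /= ?addr0 ?add0r.
Qed.

Lemma bijective_linear_inv M M' (f : {linear M -> M'}) :
  bijective f -> exists2 g : {linear M' -> M}, cancel g f & bijective g.
Proof.
case=> g fg gf; have gl : linear g.
  by move=> a u v; apply: (can_inj fg); rewrite gf linearP !gf.
by exists (linear_of gl) => //; exists f.
Qed.

Lemma projective_iso M M' (f : {linear M -> M'}) :
  bijective f -> projective M -> projective M'.
Proof.
by case/bijective_linear_inv=> g gf _; exact: (projective_retract gf).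
Qed.

Lemma pd_le_iso n M M' (f : {linear M -> M'}) :
  bijective f -> pd_le n M -> pd_le n M'.
Proof.
case: n => [|n] bf; first exact: projective_iso bf.
move=> [P [K [i [q [pP [ii qs ex] pK]]]]].
exists P, K, i, (f \o q); split=> //; case: bf => g fg gf; split=> //.
  by move=> y; have [x qx] := qs (g y); exists x; rewrite /= qx gf.
move=> y /=; split=> [E|[x <-]].
  by apply/ex; apply: (can_inj fg); rewrite E linear0.
by rewrite (ex (i x)).2 ?linear0 //; exists x.
Qed.

Lemma pd_le_prod n K P : pd_le n K -> projective P -> pd_le n (K * P)%type.
Proof.
case: n => [|n] /= pK pP; first exact: projective_prod.
case: pK => [P' [L [i [q [pP' [ii qs ex] pL]]]]].
have l1 : linear (fun l : L => (i l, 0) : (P' * P)%type).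
  by move=> a u v; rewrite linearP; congr pair; rewrite /= scaler0 addr0.
have l2 : linear (fun l : (P' * P)%type => (q l.1, l.2) : (K * P)%type).
  by move=> a u v; rewrite linearP.
exists (P' * P)%type, L, (linear_of l1), (linear_of l2); split=> //.
  exact: projective_prod.
split=> [x y [] /ii //|[y1 y2]|[y1 y2]] /=.
  by have [x <-] := qs y1; exists (x, y2).
split=> [[E ->]|[x [<- <-]]].
  by have [x <-] := (ex y1).1 E; exists x.
by congr pair; apply/ex; exists x.
Qed.

Lemma short_exact_split K X P (i : {linear K -> X}) (q : {linear X -> P}) :
  short_exact i q -> projective P ->
  exists r : {linear X -> K}, exists s : {linear P -> X},
   [/\ forall x, r (i x) = x, forall p, q (s p) = p, forall p, r (s p) = 0 &
       forall x, x = i (r x) + s (q x)].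
Proof.
move=> [ii qs ex] pP; have [s qK] := projective_section pP qs.
have H x : exists y, i y = x - s (q x).
  by apply/ex; rewrite linearB /= qK subrr.
have [r rP] := choice H.
have rl : linear r.
  move=> a u v; apply: ii; rewrite linearP !rP !linearP /=.
  by rewrite addrACA -scalerDr.
exists (linear_of rl), s; split=> // x; last by rewrite /= rP subrK.
  have qi : q (i x) = 0 by apply/ex; exists x.
  by apply: ii; rewrite /= rP qi raddf0 subr0.
by apply: ii; rewrite /= rP qK subrr raddf0.
Qed.

Lemma pd_le_extension n K X P (i : {linear K -> X}) (q : {linear X -> P}) :
  short_exact i q -> projective P -> pd_le n K -> pd_le n X.
Proof.
move=> se pP pK; have [r [s [ri qs rs E]]] := short_exact_split se pP.
have l : linear (fun u : (K * P)%type => i u.1 + s u.2).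
  by move=> a u v; rewrite !linearP scalerDr addrACA.
apply: (@pd_le_iso n (K * P)%type X (linear_of l)); last exact: pd_le_prod.
have qi z : q (i z) = 0 by case: se => _ _ ex; apply/ex; exists z.
exists (fun x => (r x, q x)) => [[u v]|x] /=.
  by rewrite !linearD /= ri rs qi qs addr0 add0r.
by rewrite -E.
Qed.

(** The sequence splits, so a cover Q of X also covers K, through the retraction
    r : X -> K. Its kernel there is an extension of P by the first syzygy of X,
    hence has the same bound as that syzygy. *)
Lemma pd_le_sub_projective n K X P (i : {linear K -> X}) (q : {linear X -> P}) :
  short_exact i q -> projective P -> pd_le n X -> pd_le n K.
Proof.
move=> se pP; have [r [s [ri qs rs E]]] := short_exact_split se pP.
case: n => [|n] /=; first exact: projective_retract ri.
move=> [Q [W [j [p [pQ se' pW]]]]].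
have rps y : exists x, (r \o p) x = y.
  have [_ ps _] := se'; have [x px] := ps (i y).
  by exists x; rewrite /= px ri.
exists Q, (kernel (r \o p)), (ker_incl _), (r \o p); split=> //.
  exact: short_exact_ker.
have jl x : (r \o p) (j x) = 0.
  case: se' => _ _ ex; rewrite /= (ex (j x)).2 ?linear0 //; by exists x.
have l : linear (fun x => mkker (jl x)).
  by move=> a u v; apply: val_inj; rewrite /= linearP.
apply: (@pd_le_extension n W _ P (linear_of l) (q \o (p \o ker_incl _))) => //.
case: se' => ji ps ex; split=> [x y|y|y].
- by move/(congr1 val) => /= /ji.
- have [x px] := ps (s y).
  have kx : (r \o p) x = 0 by rewrite /= px rs.
  by exists (mkker kx); rewrite /= px qs.
- split=> /= [qy|[x <-]] /=.
    have py : p (val y) = 0.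
      by rewrite [LHS]E qy linear0 addr0 (kernelP y : r (p _) = 0) linear0.
    have [x jx] := (ex (val y)).1 py.
    by exists x; apply: val_inj.
  by rewrite (ex (j x)).2 ?linear0 //; exists x.
Qed.

(** Schanuel's argument: the pullback X of P -> M and P' -> M is an extension of
    P by K' and of P' by K, so the bound passes from K' to X and from X to K. *)
Lemma pd_le_syzygy n K P M (i : {linear K -> P}) (q : {linear P -> M}) :
  short_exact i q -> projective P -> pd_le n.+1 M -> pd_le n K.
Proof.
move=> [ii qs ex] pP [P' [K' [i' [q' [pP' [ii' qs' ex'] pK']]]]].
have l : linear (fun u : (P * P')%type => q u.1 - q' u.2).
  by move=> a u v; rewrite !linearP addrACA -scalerDr.
pose X := kernel (linear_of l).
have Xe (u : X) : q (val u).1 = q' (val u).2.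
  by apply/subr0_eq; exact: (kernelP u).
have qi x : q (i x) = 0 by apply/ex; exists x.
have qi' x : q' (i' x) = 0 by apply/ex'; exists x.
have k1 x : linear_of l (i x, 0) = 0 by rewrite /= linear0 qi subr0.
have k2 x : linear_of l (0, i' x) = 0 by rewrite /= linear0 qi' subr0.
have l1 : linear (fun x => mkker (k1 x)).
  by move=> a u v; apply: val_inj; rewrite /= linearP; congr pair; rewrite /= scaler0 addr0.
have l2 : linear (fun x => mkker (k2 x)).
  by move=> a u v; apply: val_inj; rewrite /= linearP; congr pair; rewrite /= scaler0 addr0.
have l3 : linear (fun x : X => (val x).1) by [].
have l4 : linear (fun x : X => (val x).2) by [].
have se1 : short_exact (linear_of l2 : {linear _ -> X}) (linear_of l3).
  split=> [x y /(congr1 val) /= [] /ii' //|y|[[y1 y2] Y]] /=.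
    have [x qx] := qs' (q y).
    have kx : linear_of l (y, x) = 0 by rewrite /= qx subrr.
    by exists (mkker kx).
  have /= Yq := Xe (SubMod Y).
  split=> [y0|[x E]]; last by have /= [] := congr1 val E.
  have [x ix] : exists x, i' x = y2 by apply/ex'; rewrite -Yq y0 linear0.
  by exists x; apply: val_inj; rewrite /= ix y0.
have se2 : short_exact (linear_of l1 : {linear _ -> X}) (linear_of l4).
  split=> [x y /(congr1 val) /= [] /ii //|y|[[y1 y2] Y]] /=.
    have [x qx] := qs (q' y).
    have kx : linear_of l (x, y) = 0 by rewrite /= qx subrr.
    by exists (mkker kx).
  have /= Yq := Xe (SubMod Y).
  split=> [y0|[x E]]; last by have /= [] := congr1 val E.
  have [x ix] : exists x, i x = y1 by apply/ex; rewrite Yq y0 linear0.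
  by exists x; apply: val_inj; rewrite /= ix y0.
exact: (pd_le_sub_projective se2 pP' (pd_le_extension se1 pP pK')).
Qed.

End ShortExact.

(** * Projective resolutions *)

Section Resolutions.
Variable A : pzRingType.
Implicit Types M : lmodType A.

Lemma has_projective_resolution_pd_le n M :
  has_projective_resolution M n -> pd_le n M.
Proof.
elim: n M => [|n IHn] M [P [d [eps [pP P0 es ex0 ex]]]] /=.
  have ei : injective eps.
    move=> x y exy; apply: subr0_eq.
    have /ex0[z <-] : eps (x - y) = 0 by rewrite linearB exy subrr.
    by rewrite (P0 1%N isT z) linear0.
  have [g gP] := choice es.
  by apply: (projective_iso (f := eps)) => //; exists g => // x; apply: ei.
exists (P 0%N), (kernel eps), (ker_incl eps), eps; split=> //.
  exact: short_exact_ker.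
have de x : eps (d 0%N x) = 0 by apply/ex0; exists x.
have l : linear (fun x => mkker (de x)).
  by move=> a u v; apply: val_inj; rewrite /= linearP.
apply: IHn; exists (fun i => P i.+1), (fun i => d i.+1), (linear_of l); split=> //.
- by move=> i lt_ni; apply: P0.
- by move=> y; have [x dx] := (ex0 (val y)).1 (kernelP y); exists x; apply: val_inj.
- by move=> x; rewrite -ex; split=> [/(congr1 val)|dx] //; apply: val_inj.
Qed.

Definition zero_module : lmodType A := kernel (idfun : {linear A^o -> A^o}).

Lemma zero_moduleP (z : zero_module) : z = 0.
Proof. by apply: val_inj; rewrite [LHS](kernelP z). Qed.

Lemma zero_linear M M' : linear (fun _ : M => 0 : M').
Proof. by move=> a u v; rewrite scaler0 addr0. Qed.

Lemma projective_zero_module : projective zero_module.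
Proof.
move=> M N g f _; exists (linear_of (@zero_linear zero_module M)) => x.
by rewrite /= linear0 (zero_moduleP x) linear0.
Qed.

Lemma pd_le_has_projective_resolution n M :
  pd_le n M -> has_projective_resolution M n.
Proof.
elim: n M => [|n IHn] M /= => [pM|[P [K [i [q [pP [ii qs ex]]]]]]].
  pose P i : lmodType A := if i is 0%N then M else zero_module.
  exists P, (fun i => linear_of (@zero_linear zero_module (P i))), idfun; split=> //=.
  - by case=> // i; exact: projective_zero_module.
  - by case=> // i _ z; exact: zero_moduleP.
  - by move=> y; exists y.
  - by move=> x; split=> [->|[_ <-]] //; exists 0.
  - by move=> j x; split=> // _; exists 0; rewrite [RHS]zero_moduleP.
case/IHn=> [P' [d [eps [pP' P0 es ex0 exd]]]].
pose P2 j : lmodType A := if j is l.+1 then P' l else P.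
exists P2, (fun j => match j return {linear P2 j.+1 -> P2 j} with
  | 0%N => (i \o eps : {linear P' 0%N -> P}) | l.+1 => d l end), q; split=> //.
- by case.
- by case=> // j lt_nj z; apply: P0.
- move=> x; rewrite ex; split=> [[y <-]|[z <-]]; last by exists (eps z).
  by have [z <-] := es y; exists z.
- case=> [|j] x; last exact: exd.
  rewrite -ex0 /=; split=> [|->]; last exact: linear0.
  by rewrite -(linear0 i) => /ii.
Qed.

End Resolutions.

(** * Free modules *)

Section Free.
Variables (A : pzRingType) (T : choiceType).

(** A copy of [{malg A[T]}], whose own module structure asks for a nontrivial ring
    of scalars, whereas A may be the zero ring. *)
Definition free_module : Type := {malg A[T]}.
HB.instance Definition _ := GRing.Zmodule.on free_module.

Definition free_scale (a : A) (x : free_module) : free_module :=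
  [malg t in msupp (x : {malg A[T]}) => a * x@_t].

Lemma free_scaleE a x t : (free_scale a x)@_t = a * x@_t.
Proof. by rewrite mcoeffE; case: msuppP; rewrite ?mulr0. Qed.

Fact free_scaleA a b x : free_scale a (free_scale b x) = free_scale (a * b) x.
Proof. by apply/malgP => t; rewrite !free_scaleE mulrA. Qed.
Fact free_scale1 : left_id 1 free_scale.
Proof. by move=> x; apply/malgP => t; rewrite free_scaleE mul1r. Qed.
Fact free_scaleDr : right_distributive free_scale +%R.
Proof. by move=> a x y; apply/malgP => t; rewrite !(free_scaleE, mcoeffD) mulrDr. Qed.
Fact free_scaleDl x : {morph free_scale^~ x : a b / a + b}.
Proof. by move=> a b; apply/malgP => t; rewrite !(free_scaleE, mcoeffD) mulrDl. Qed.
HB.instance Definition _ := GRing.Zmodule_isLmodule.Build A free_module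
  free_scaleA free_scale1 free_scaleDr free_scaleDl.

Definition free_gen (t : T) : free_module := mkmalgU t 1.

Section Lift.
Variables (M : lmodType A) (u : T -> M).

Definition free_lift_fun (x : free_module) : M :=
  \sum_(t <- msupp (x : {malg A[T]})) x@_t *: u t.

Lemma free_lift_funE (d : {fset T}) (x : free_module) :
  fsubset (msupp (x : {malg A[T]})) d ->
  free_lift_fun x = \sum_(t <- d) x@_t *: u t.
Proof.
move=> xd; rewrite /free_lift_fun; apply: big_fset_incl => // t _ /mcoeff_outdom ->.
by rewrite scale0r.
Qed.

Lemma free_lift_linear : linear free_lift_fun.
Proof.
move=> a x y; pose d := fsetU (msupp (a *: x : {malg A[T]}))
  (fsetU (msupp (x : {malg A[T]})) (msupp (y : {malg A[T]}))).
rewrite (@free_lift_funE d (a *: x + y)) ?(@free_lift_funE d x) ?(@free_lift_funE d y).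
- rewrite scaler_sumr -big_split; apply: eq_bigr => t _ /=.
  by rewrite mcoeffD free_scaleE scalerDl scalerA.
- by rewrite /d fsetUA fsubsetUr.
- by rewrite /d fsetUCA fsubsetUl.
- apply: fsubset_trans (msuppD_le _ _) _.
  by rewrite fsubUset {1}/d fsubsetUl /d fsetUA fsubsetUr.
Qed.

Definition free_lift : {linear free_module -> M} := linear_of free_lift_linear.

Lemma free_lift_gen t : free_lift (free_gen t) = u t.
Proof.
rewrite /free_lift /= (@free_lift_funE (fset1 t)) ?msuppU_le //.
by rewrite big_seq_fset1 mcoeffUU scale1r.
Qed.

End Lift.

Lemma free_ext (M : lmodType A) (f g : {linear free_module -> M}) :
  (forall t, f (free_gen t) = g (free_gen t)) -> f =1 g.
Proof.
move=> fg x.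
have -> : x = \sum_(t <- msupp (x : {malg A[T]})) x@_t *: free_gen t.
  rewrite [LHS]monalgE; apply: eq_bigr => t _; apply/malgP => s.
  by rewrite free_scaleE !mcoeffU; case: eqP; rewrite ?mulr1 ?mulr0.
by rewrite !linear_sum; apply: eq_bigr => t _; rewrite !linearZ /= fg.
Qed.

Lemma free_projective : projective free_module.
Proof.
move=> M N g f gs; have [u gu] := choice (fun t => gs (f (free_gen t))).
exists (free_lift u) => x; apply: (free_ext (f := g \o free_lift u)) => t /=.
by rewrite -[free_lift_fun u _]/(free_lift u _) free_lift_gen.
Qed.

End Free.

Lemma enough_projectives (A : pzRingType) (M : lmodType A) :
  exists (F : lmodType A) (q : {linear F -> M}),
    projective F /\ forall y, exists x, q x = y.
Proof.
exists (free_module A M), (free_lift id); split; first exact: free_projective.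
by move=> y; exists (free_gen A y); rewrite free_lift_gen.
Qed.

(** * Restriction of scalars *)

Section Restriction.
Variables (A B : pzRingType) (phi : {rmorphism A -> B}).

Section Object.
Variable X : lmodType B.
Definition restr_type : Type := X.
HB.instance Definition _ := GRing.Zmodule.on restr_type.
Definition restr_scale (a : A) (x : restr_type) : restr_type :=
  @GRing.scale B X (phi a) x.
Fact restr_scaleA a b x : restr_scale a (restr_scale b x) = restr_scale (a * b) x.
Proof. by rewrite /restr_scale scalerA rmorphM. Qed.
Fact restr_scale1 : left_id 1 restr_scale.
Proof. by move=> x; rewrite /restr_scale rmorph1 scale1r. Qed.
Fact restr_scaleDr : right_distributive restr_scale +%R.
Proof. by move=> a x y; rewrite /restr_scale scalerDr. Qed.
Fact restr_scaleDl x : {morph restr_scale^~ x : a b / a + b}.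
Proof. by move=> a b; rewrite /restr_scale rmorphD scalerDl. Qed.
HB.instance Definition _ := GRing.Zmodule_isLmodule.Build A restr_type
  restr_scaleA restr_scale1 restr_scaleDr restr_scaleDl.
Definition restr : lmodType A := restr_type.
End Object.

Lemma restr_map_linear (X Y : lmodType B) (f : {linear X -> Y}) :
  linear (f : restr X -> restr Y).
Proof. by move=> a u v; rewrite [LHS](linearP f). Qed.
Definition restr_map (X Y : lmodType B) (f : {linear X -> Y}) :
  {linear restr X -> restr Y} := linear_of (@restr_map_linear X Y f).

End Restriction.

(** * Linear sections over a field *)

Section VectorSpaceSection.
Variables (k : fieldType) (U V : lmodType k) (g : {linear U -> V}).
Hypothesis gs : forall y, exists x, g x = y.

Let trivial_meet (W : set U) :=
  (forall a u v, W u -> W v -> W (a *: u + v)) /\ forall u, W u -> g u = 0 -> u = 0.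

(** A maximal subspace W meeting the kernel of g trivially, given by Zorn's
    lemma, is mapped bijectively onto V: if y = g u were not in the image of W,
    then W + k u would still meet the kernel trivially. *)
Lemma linear_section : exists s : {linear V -> U}, forall y, g (s y) = y.
Proof.
have [W [[WD W0] Wmax]] : exists W, trivial_meet W /\
    forall W', W `<` W' -> ~ trivial_meet W'.
  apply: Zorn_bigcup => F FT Ftot; split.
    move=> a u v [X FX Xu] [Y FY Yv].
    have [XY|YX] := Ftot _ _ FX FY.
      by exists Y => //; apply: (FT _ FY).1 => //; apply: XY.
    by exists X => //; apply: (FT _ FX).1 => //; apply: YX.
  by move=> u [X FX Xu]; apply: (FT _ FX).2.
(* The empty set satisfies [trivial_meet], but it is not maximal. *)
have W00 : W 0.
  apply: contrapT => nW0; apply: (Wmax [set 0]).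
    split=> [u Wu|/(_ 0 erefl) //].
    by case: nW0; have := WD (-1) u u Wu Wu; rewrite scaleN1r addNr.
  by split=> [a u v -> ->|u ->] //; rewrite scaler0 addr0.
have gW y : exists u, W u /\ g u = y.
  apply: contrapT => nWy; have [u gu] := gs y.
  pose W' := [set v | exists c w, W w /\ v = c *: u + w].
  apply: (Wmax W').
    split=> [w Ww|sub]; first by exists 0, w; rewrite scale0r add0r.
    case: nWy; exists u; split=> //; apply: sub.
    by exists 1, 0; rewrite scale1r addr0.
  split=> [a _ _ [c [w [Ww ->]]] [c' [w' [Ww' ->]]]|_ [c [w [Ww ->]]]].
    exists (a * c + c'), (a *: w + w'); split; first exact: WD.
    by rewrite scalerDr scalerDl scalerA addrACA.
  rewrite linearP gu => E; have [c0|c0] := eqVneq c 0.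
    by move: E; rewrite c0 !scale0r !add0r; apply: W0.
  case: nWy; exists (- c^-1 *: w); split.
    by rewrite -[_ *: w]addr0; apply: WD.
  rewrite linearZ /=; move/eqP: E; rewrite addrC addr_eq0 => /eqP ->.
  by rewrite scaleNr scalerN opprK scalerA mulVf ?scale1r.
have [s sP] := choice gW.
have sl : linear s.
  move=> a u v; apply/eqP; rewrite -subr_eq0; apply/eqP; apply: W0.
    rewrite [X in W X]addrC -scaleN1r; apply: (WD); last by case: (sP (a *: u + v)).
    by apply: WD; [case: (sP u)|case: (sP v)].
  rewrite linearB linearP !(sP _).2 subrr //.
by exists (linear_of sl) => y; case: (sP y).
Qed.

End VectorSpaceSection.

(** * Values of the homological dimensions *)

Lemma regular_projective (A : pzRingType) : projective (A^o : lmodType A).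
Proof.
move=> M N g f gs; have [u gu] := gs (f 1).
have l : linear (fun a : A^o => (a : A) *: u).
  by move=> a b c; rewrite scalerDl scalerA.
exists (linear_of l) => a /=.
by rewrite linearZ /= gu -linearZ /= /GRing.scale /= mulr1.
Qed.

Lemma regular_finitely_generated (A : pzRingType) :
  finitely_generated (A^o : lmodType A).
Proof.
exists 1%N, (fun=> 1) => m; exists (fun=> m).
by rewrite big_ord_recl big_ord0 addr0 /GRing.scale /= mulr1.
Qed.

Section Dimensions.
Local Open Scope ereal_scope.

Lemma infimum_nat (S : set nat) n : S n ->
  exists m, [/\ S m, forall i, S i -> (m <= i)%N &
     infimum +oo [set i%:Z%:E | i in S] = m%:Z%:E].
Proof.
move=> Sn; have exS : exists i, `[< S i >] by exists n; apply/asboolP.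
case: (ex_minnP exS) => m /asboolP Sm min_m.
have le_m i : S i -> (m <= i)%N by move=> Si; apply/min_m/asboolP.
exists m; split=> //; rewrite /infimum.
case: eqP => [E|_].
  have Em : [set i%:Z%:E | i in S] (m%:Z%:E) by exists m.
  by rewrite E in Em.
apply: xget_subset1; last exact: is_subset1_infimums.
split=> [_ [i Si <-]|y lb]; last by apply: lb; exists m.
by rewrite lee_fin lez_nat le_m.
Qed.

(** A set of naturals has a maximum, or is empty with supremum -oo, or is
    unbounded with supremum +oo. *)
Lemma supremums_nat (S : set (\bar int)) :
  (forall e, S e -> exists n : nat, e = n%:Z%:E) -> supremums S !=set0.
Proof.
move=> Snat; have [S0|/eqP/set0P[e0 Se0]] := pselect (S = set0).
  by exists -oo; split=> [x|y _]; [rewrite S0|exact: leNye].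
have [[N bN]|unb] := pselect (exists N : nat, forall n : nat, S n%:Z%:E -> (n <= N)%N).
  have exS : exists i : nat, `[< S i%:Z%:E >].
    by have [n E] := Snat _ Se0; exists n; apply/asboolP; rewrite -E.
  have bS i : `[< S i%:Z%:E >] -> (i <= N)%N by move/asboolP/bN.
  case: (ex_maxnP exS bS) => m /asboolP Sm max_m.
  exists (m%:Z%:E); split=> [e Se|y ub]; last exact: ub.
  have [n E] := Snat _ Se; rewrite E lee_fin lez_nat.
  by apply/max_m/asboolP; rewrite -E.
exists +oo; split=> [e _|y ub]; first exact: leey.
case: y ub => [r| |] ub //; last first.
  by have [n E] := Snat _ Se0; have := ub _ Se0; rewrite E.
case: unb; exists `|r|%N => n /ub; rewrite lee_fin -lez_nat => /le_trans-> //.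
by rewrite abszE ler_norm.
Qed.

Variable A : pzRingType.
Implicit Types M : lmodType A.

Lemma pd_attained n M : pd_le n M ->
  exists m, [/\ pd_le m M, (m <= n)%N & pd M = m%:Z%:E].
Proof.
move=> /pd_le_has_projective_resolution pn; have [m [pm min_m E]] := infimum_nat pn.
by exists m; split=> //; [exact: has_projective_resolution_pd_le|exact: min_m].
Qed.

Lemma pd_finite M : pd M < +oo -> exists2 n, pd_le n M & pd M = n%:Z%:E.
Proof.
move=> pM; suff [n /pd_attained[m []]] : exists n, pd_le n M by exists m.
apply: contrapT => nM; move: pM; rewrite /pd /infimum.
case: eqP => // /eqP/set0P[_ [n pn _]].
by case: nM; exists n; exact: has_projective_resolution_pd_le.
Qed.

Lemma findim_ub M n : finitely_generated M -> pd_le n M -> pd M <= findim A.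
Proof.
move=> fM /pd_attained[m [_ _ E]]; apply: ge_supremum_Nmem.
  by apply: supremums_nat => _ [N [_ /pd_finite[i _ Ei] ->]]; exists i.
by exists M; rewrite {1}E ltry.
Qed.

Lemma findim_lub (y : \bar int) :
  (forall M, finitely_generated M -> pd M < +oo -> pd M <= y) -> findim A <= y.
Proof.
move=> H; rewrite /findim /supremum; case: eqP => [_|_]; first exact: leNye.
case: xgetP => [e _ [_ lub]|_]; last exact: leNye.
by apply: lub => _ [M [fM pM ->]]; apply: H.
Qed.

Lemma findim_ge0 : 0 <= findim A.
Proof.
have fr := regular_finitely_generated A.
have p0 : pd_le 0 (A^o : lmodType A) := @regular_projective A.
apply: le_trans (findim_ub fr p0); have [m [_ _ ->]] := pd_attained p0.
by rewrite lee_fin.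
Qed.

End Dimensions.

(** * Modules over an algebra generated by a quiver *)

(** The images of scalars, vertices and arrows are fields of their own, tied to
    [qa_pi] by equations only: over a variable L they are opaque, and
    unification never unfolds paths and finitely supported functions. *)
Record quiver_algebra (k : fieldType) (Q : quiver) := QuiverAlgebra {
  qa_ring :> pzRingType;
  qa_pi : {rmorphism path_algebra k Q -> qa_ring};
  qa_scalar : {rmorphism k -> qa_ring};
  qa_idem : vertex Q -> qa_ring;
  qa_arrow : arrow Q -> qa_ring;
  qa_surj : forall l, exists f, qa_pi f = l;
  qa_scalarE : forall c, qa_scalar c = qa_pi (c *: (1 : path_algebra k Q));
  qa_idemE : forall v, qa_idem v = qa_pi (path_elt k (trivial_path v));
  qa_arrowE : forall a, qa_arrow a = qa_pi (path_elt k (arrow_path a)) }.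

Section QuiverAlgebra.
Variables (k : fieldType) (Q : quiver) (L : quiver_algebra k Q).
Local Notation kQ := (path_algebra k Q).
Local Notation pi := (qa_pi L).
Local Notation sc := (qa_scalar L).
Local Notation e := (qa_idem L).
Local Notation "[ a ]" := (qa_arrow L a).

Lemma qa_scalar_pi c f : sc c * pi f = pi (c *: f).
Proof. by rewrite qa_scalarE -rmorphM -path_algebra_scaleAl mul1r. Qed.

Lemma qa_scalar_comm c (l : L) : sc c * l = l * sc c.
Proof.
have [f <-] := qa_surj l.
by rewrite qa_scalar_pi qa_scalarE -rmorphM -path_algebra_scaleAr mulr1.
Qed.

Lemma qa_idemM u v : e u * e v = if u == v then e u else 0.
Proof.
rewrite !qa_idemE -rmorphM [_ * _]path_mul_elt /path_elt_comp; case: eqVneq => [<-|uv].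
  by have -> : path_comp (trivial_path u) (trivial_path u) = Some (trivial_path u)
    by apply/path_compP.
by rewrite path_comp_None ?rmorph0 //; apply/eqP.
Qed.

Lemma qa_idem_sum : \sum_v e v = 1.
Proof.
rewrite -(rmorph1 pi) -[1 in RHS]/(path_one k Q) /path_one rmorph_sum.
by apply: eq_bigr => v _; exact: qa_idemE.
Qed.

Lemma qa_idem_arrow v a : e v * [a] = if v == src a then [a] else 0.
Proof.
rewrite qa_idemE qa_arrowE -rmorphM [_ * _]path_mul_elt /path_elt_comp.
case: eqVneq => [->|uv].
  by have -> : path_comp (trivial_path (src a)) (arrow_path a) = Some (arrow_path a)
    by apply/path_compP.
by rewrite path_comp_None ?rmorph0 //; apply/eqP.
Qed.

Lemma qa_arrow_idem v a : [a] * e v = if v == tgt a then [a] else 0.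
Proof.
rewrite qa_idemE qa_arrowE -rmorphM [_ * _]path_mul_elt /path_elt_comp.
case: eqVneq => [->|uv].
  by have -> : path_comp (arrow_path a) (trivial_path (tgt a)) = Some (arrow_path a)
    by apply/path_compP.
by rewrite path_comp_None ?rmorph0 //; apply/eqP; rewrite eq_sym.
Qed.

Lemma path_cons_elt a (p q : qpath Q) :
  path_src p = src a -> path_src q = tgt a -> path_arrows p = a :: path_arrows q ->
  path_elt k p = path_elt k (arrow_path a) * path_elt k q.
Proof.
move=> pa qa E; rewrite [RHS]path_mul_elt /path_elt_comp.
by have -> : path_comp (arrow_path a) q = Some p by apply/path_compP.
Qed.

Lemma qa_path_cons a (p q : qpath Q) :
  path_src p = src a -> path_src q = tgt a -> path_arrows p = a :: path_arrows q ->
  pi (path_elt k p) = [a] * pi (path_elt k q).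
Proof.
by move=> pa qa E; rewrite (path_cons_elt pa qa E) qa_arrowE -rmorphM.
Qed.

Lemma qpath_ind (P : qpath Q -> Prop) :
  (forall v, P (trivial_path v)) ->
  (forall a p q, path_src p = src a -> path_src q = tgt a ->
     path_arrows p = a :: path_arrows q -> P q -> P p) ->
  forall p, P p.
Proof.
move=> P0 PS [[u s] /= ws]; elim: s u ws => [|a s IHs] u ws.
  by have -> : @QPath Q (u, [::]) ws = trivial_path u by apply: val_inj.
have /andP[/eqP Eu ws'] := ws; exact: (PS a _ (@QPath _ (tgt a, s) ws')).
Qed.

Lemma qa_ind (P : L -> Prop) :
  P 0 -> (forall l l', P l -> P l' -> P (l + l')) ->
  (forall c l, P l -> P (sc c * l)) ->
  (forall v, P (e v)) -> (forall a l, P l -> P ([a] * l)) -> forall l, P l.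
Proof.
move=> P0 PD PZ Pe Pa l.
have [f <-] := qa_surj l; elim/path_algebra_ind: f => [|f g Pf Pg|c f Pf|p].
- by rewrite rmorph0.
- by rewrite rmorphD; apply: PD.
- by rewrite -qa_scalar_pi; apply: PZ.
- elim/qpath_ind: p => [v|a p q pa qa E Pq]; first by rewrite -qa_idemE.
  by rewrite (qa_path_cons pa qa E); exact: Pa.
Qed.

Definition kmod (M : lmodType L) : lmodType k := restr sc M.

Lemma kmodE (M : lmodType L) c (m : kmod M) :
  c *: m = sc c *: (m : M) :> M.
Proof. by []. Qed.

Lemma scale_kmod_linear (M : lmodType L) (l : L) :
  linear (fun m : kmod M => (l *: (m : M)) : kmod M).
Proof.
by move=> c u v; rewrite !kmodE scalerDr !scalerA qa_scalar_comm.
Qed.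

Lemma qa_linear (M N : lmodType L) (f : M -> N) :
  linear (f : kmod M -> kmod N) ->
  (forall v m, f (e v *: m) = e v *: f m) ->
  (forall a m, f ([a] *: m) = [a] *: f m) -> linear f.
Proof.
move=> fk fe fa.
have fD u v : f (u + v) = f u + f v.
  by have := fk 1 u v; rewrite !kmodE !rmorph1 !scale1r.
have f0 : f 0 = 0 by apply: (addIr (f 0)); rewrite -fD !add0r.
have fZ c u : f (sc c *: u) = sc c *: f u.
  by have := fk c u 0; rewrite !kmodE f0 !addr0.
suff fl l u : f (l *: u) = l *: f u by move=> l u v; rewrite fD fl.
elim/qa_ind: l u => [|l l' Hl Hl'|c l Hl|v|a l Hl] u.
- by rewrite !scale0r.
- by rewrite !scalerDl fD Hl Hl'.
- by rewrite -!scalerA fZ Hl.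
- exact: fe.
- by rewrite -!scalerA fa Hl.
Qed.

Definition killed (E : pred (arrow Q)) (N : lmodType L) : Prop :=
  forall a (n : N), E a -> [a] *: n = 0.

(** * Changing the action of arrows outside the relations *)

Section Twist.
Variables (E : pred (arrow Q)) (rs : seq kQ).
Hypothesis pi_ker : forall f, pi f = 0 <-> (ideal_gen [set` rs] : set kQ) f.
Hypothesis rs_avoid : forall f p a,
  f \in rs -> p \in msupp f -> a \in path_arrows p -> ~~ E a.

Variables (M : lmodType L) (alpha : arrow Q -> {linear kmod M -> kmod M}).

(** A product of paths p * q is p followed by q, so on a left module an arrow a
    sends e_(tgt a) M to e_(src a) M; the two idempotents force this on the new
    action. *)
Definition arrow_act a (m : M) : M :=
  if E a then e (src a) *: (alpha a (e (tgt a) *: m) : M) else [a] *: m.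

Lemma arrow_act_linear a : linear (arrow_act a : kmod M -> kmod M).
Proof.
rewrite /arrow_act; case: (E a) => c u v; last exact: scale_kmod_linear.
have -> := scale_kmod_linear (e (tgt a)) c u v.
by rewrite linearP; exact: scale_kmod_linear.
Qed.
HB.instance Definition _ a :=
  GRing.isLinear.Build k (kmod M) (kmod M) _ (arrow_act a : kmod M -> kmod M)
   (arrow_act_linear a).

Lemma idem_arrow_act v a m :
  e v *: arrow_act a m = if v == src a then arrow_act a m else 0.
Proof.
rewrite /arrow_act; case: (E a); rewrite scalerA.
  by rewrite qa_idemM; case: eqVneq => [<-|] //; rewrite scale0r.
by rewrite qa_idem_arrow; case: eqVneq => // _; rewrite scale0r.
Qed.

Lemma arrow_act_idem v a m :
  arrow_act a (e v *: m) = if v == tgt a then arrow_act a m else 0.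
Proof.
rewrite /arrow_act; case: (E a); rewrite scalerA.
  rewrite qa_idemM eq_sym; case: eqVneq => // _.
  by rewrite scale0r (raddf0 (alpha a)) scaler0.
by rewrite qa_arrow_idem; case: eqVneq => // _; rewrite scale0r.
Qed.

Definition walk_act (s : seq (arrow Q)) (m : M) : M := foldr arrow_act m s.

Definition path_act (p : qpath Q) (m : M) : M :=
  e (path_src p) *: walk_act (path_arrows p) m.

Lemma path_act_linear p : linear (path_act p : kmod M -> kmod M).
Proof.
move=> c u v; rewrite /path_act.
have -> : walk_act (path_arrows p) (c *: u + v) =
    c *: (walk_act (path_arrows p) u : kmod M) + walk_act (path_arrows p) v.
  by elim: (path_arrows p) => //= a s ->; exact: arrow_act_linear.
exact: scale_kmod_linear.
Qed.

Lemma walk_act_idem u s v m : walk u s ->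
  e u *: walk_act s (e v *: m) =
  if walk_end u s == v then e u *: walk_act s m else 0.
Proof.
elim: s u => [|a s IHs] u /=.
  by move=> _; rewrite scalerA qa_idemM; case: eqP; rewrite ?scale0r.
case/andP=> /eqP <- ws.
rewrite -/(walk_act s m) -/(walk_act s (e v *: m)).
have aE x : arrow_act a x = arrow_act a (e (tgt a) *: x).
  by rewrite arrow_act_idem eqxx.
rewrite !idem_arrow_act eqxx [LHS]aE IHs // /walk_end /= -/(walk_end _ s).
case: ifP => _; first by rewrite -aE.
exact: (raddf0 (arrow_act a : {linear kmod M -> kmod M})).
Qed.

Lemma path_act_comp p q m :
  path_act p (path_act q m) =
  if path_comp p q is Some r then path_act r m else 0.
Proof.
have wp : walk (path_src p) (path_arrows p) by case: p.
rewrite {1}/path_act walk_act_idem // -/(path_tgt p).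
case: eqVneq => [pq|/eqP pq]; last by rewrite path_comp_None.
have [r Er] := path_comp_ex pq; rewrite Er.
have [_ Es Ea] := (path_compP _ _ _).1 Er.
by rewrite /path_act Es Ea /walk_act foldr_cat.
Qed.

Definition alg_act (f : kQ) (m : M) : M :=
  @free_lift_fun k (qpath Q) (kmod M) (path_act^~ m) f.

Lemma alg_actD f g m : alg_act (f + g) m = alg_act f m + alg_act g m.
Proof.
have := @free_lift_linear k (qpath Q) (kmod M) (path_act^~ m) 1 f g.
by rewrite !scale1r.
Qed.

Lemma alg_actZ c f m : alg_act (c *: f) m = sc c *: alg_act f m.
Proof.
have := linearZ_LR (@free_lift k (qpath Q) (kmod M) (path_act^~ m)) c f.
apply: etrans; congr free_lift_fun.
by apply/malgP => p; rewrite mcoeffZ free_scaleE.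
Qed.

Lemma alg_act_path p m : alg_act (path_elt k p) m = path_act p m.
Proof. exact: (@free_lift_gen k (qpath Q) (kmod M) (path_act^~ m) p). Qed.

Lemma alg_act0l m : alg_act 0 m = 0.
Proof. by rewrite -(scale0r 0) alg_actZ rmorph0 scale0r. Qed.

Lemma alg_act_linear f : linear (alg_act f : kmod M -> kmod M).
Proof.
elim/path_algebra_ind: f => [|f g Hf Hg|c f Hf|p] d u v.
- by rewrite !alg_act0l scaler0 addr0.
- by rewrite !alg_actD Hf Hg scalerDr addrACA.
- rewrite !alg_actZ Hf; exact: scale_kmod_linear.
- by rewrite !alg_act_path; exact: path_act_linear.
Qed.

Lemma alg_actDr f u v : alg_act f (u + v) = alg_act f u + alg_act f v.
Proof.
have := alg_act_linear f 1 u v.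
by rewrite !kmodE !rmorph1 !scale1r.
Qed.

Lemma alg_act0r f : alg_act f 0 = 0.
Proof. by apply: (addIr (alg_act f 0)); rewrite -alg_actDr !add0r. Qed.

Lemma alg_actZr f c u : alg_act f (sc c *: u) = sc c *: alg_act f u.
Proof.
by have := alg_act_linear f c u 0; rewrite !kmodE alg_act0r !addr0.
Qed.

Lemma alg_actM f g m : alg_act f (alg_act g m) = alg_act (f * g) m.
Proof.
elim/path_algebra_ind: f => [|f f' E1 E2|c f E1|p].
- by rewrite mul0r !alg_act0l.
- by rewrite mulrDl !alg_actD E1 E2.
- have -> : c *: f * g = c *: (f * g) := esym (path_algebra_scaleAl c f g).
  apply: (etrans (alg_actZ c f _)); apply: (etrans _ (esym (alg_actZ c (f * g) m))).
  exact: (congr1 (fun z : M => sc c *: z) E1).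
elim/path_algebra_ind: g => [|g g' E1 E2|c g E1|q].
- by rewrite mulr0 !alg_act0l alg_act0r.
- by rewrite mulrDr !alg_actD alg_actDr E1 E2.
- have -> : path_elt k p * (c *: g) = c *: (path_elt k p * g).
    exact: esym (path_algebra_scaleAr c (path_elt k p) g).
  apply: (etrans _ (esym (alg_actZ c (path_elt k p * g) m))).
  apply: (etrans (congr1 (alg_act (path_elt k p)) (alg_actZ c g m))).
  apply: (etrans (alg_actZr (path_elt k p) c (alg_act g m))).
  exact: (congr1 (fun z : M => sc c *: z) E1).
rewrite !alg_act_path path_act_comp [_ * _]path_mul_elt /path_elt_comp.
by case: path_comp => [r|]; rewrite ?alg_act_path ?alg_act0l.
Qed.

Lemma alg_act1 m : alg_act 1 m = m.
Proof.
rewrite -[1]/(path_one k Q) /path_one.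
rewrite -[RHS]scale1r -qa_idem_sum scaler_suml.
rewrite (big_morph (alg_act^~ m) (fun f g => alg_actD f g m) (alg_act0l m)).
by apply: eq_bigr => v _; rewrite alg_act_path.
Qed.

(** A path without arrows of E acts as before; as the relations involve only such
    paths, they keep acting by zero, and the action of kQ descends to L. *)
Lemma path_act_avoid p m : (forall a, a \in path_arrows p -> ~~ E a) ->
  path_act p m = pi (path_elt k p) *: m.
Proof.
elim/qpath_ind: p => [v _|a p q pa qa Ep IHp avoid]; first by rewrite -qa_idemE.
rewrite (qa_path_cons pa qa Ep) -scalerA -IHp; last first.
  by move=> b bq; apply: avoid; rewrite Ep inE bq orbT.
rewrite /path_act Ep pa /= idem_arrow_act eqxx.
rewrite /arrow_act (negbTE (avoid a _)) ?Ep ?mem_head //.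
by rewrite scalerA qa_arrow_idem qa eqxx.
Qed.

Lemma alg_act_rel f m : f \in rs -> alg_act f m = 0.
Proof.
move=> f_rs; have f0 : pi f = 0 by apply/pi_ker => J [_ +]; apply.
rewrite -[RHS](scale0r m) -f0 [in pi f](path_eltE f) rmorph_sum scaler_suml.
rewrite /alg_act /free_lift_fun; apply: eq_big_seq => p pf.
rewrite -qa_scalar_pi -scalerA -path_act_avoid // => a; exact: rs_avoid f_rs pf.
Qed.

Lemma alg_act_ideal f m : pi f = 0 -> alg_act f m = 0.
Proof.
move/pi_ker => If; pose J : set kQ := [set g | forall m, alg_act g m = 0].
suff : J f by exact.
apply: If; split=> [|g g_rs n]; last exact: alg_act_rel.
split=> [n|g h Jg Jh n|g h Jh n|g h Jh n]; first exact: alg_act0l.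
- by rewrite alg_actD Jg Jh addr0.
- by rewrite -alg_actM Jh alg_act0r.
- by rewrite -alg_actM Jh.
Qed.

Definition twist_type : Type := M.
HB.instance Definition _ := GRing.Zmodule.on twist_type.

Definition twist_scale (l : L) (m : twist_type) : twist_type :=
  alg_act (sval (cid (qa_surj l))) m.

Lemma twist_scaleE f m : twist_scale (pi f) m = alg_act f m.
Proof.
rewrite /twist_scale; case: cid => g /= E'.
rewrite -[g](subrK f) alg_actD alg_act_ideal ?add0r //.
by rewrite rmorphB E' subrr.
Qed.

Fact twist_scaleA a b x : twist_scale a (twist_scale b x) = twist_scale (a * b) x.
Proof.
have [[f <-] [g <-]] := (qa_surj a, qa_surj b).
by rewrite -rmorphM !twist_scaleE alg_actM.
Qed.
Fact twist_scale1 : left_id 1 twist_scale.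
Proof. by move=> x; rewrite -(rmorph1 pi) twist_scaleE alg_act1. Qed.
Fact twist_scaleDr : right_distributive twist_scale +%R.
Proof.
by move=> a x y; have [f <-] := qa_surj a; rewrite !twist_scaleE alg_actDr.
Qed.
Fact twist_scaleDl x : {morph twist_scale^~ x : a b / a + b}.
Proof.
move=> a b; have [[f <-] [g <-]] := (qa_surj a, qa_surj b).
by rewrite -rmorphD !twist_scaleE alg_actD.
Qed.
HB.instance Definition _ := GRing.Zmodule_isLmodule.Build L twist_type
  twist_scaleA twist_scale1 twist_scaleDr twist_scaleDl.

Definition twist : lmodType L := twist_type.

Lemma twist_scalar c (m : twist) : sc c *: m = sc c *: (m : M) :> M.
Proof.
by rewrite -[LHS]/(twist_scale (sc c) m) {1}qa_scalarE twist_scaleE alg_actZ alg_act1.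
Qed.

Lemma twist_idem v (m : twist) : e v *: m = e v *: (m : M) :> M.
Proof. by rewrite {1}qa_idemE [LHS]twist_scaleE alg_act_path. Qed.

Lemma twist_arrow a (m : twist) : [a] *: m = arrow_act a m :> M.
Proof.
rewrite {1}qa_arrowE [LHS]twist_scaleE alg_act_path /path_act /=.
by rewrite idem_arrow_act eqxx.
Qed.

End Twist.
End QuiverAlgebra.

(** * Modules over a quotient ring *)

Section Annihilated.
Variables (A : pzRingType) (J : ideal A).
Local Notation B := (ring_quot J).

Section Object.
Variable N : lmodType A.

Lemma ann_is_submodule : is_submodule [set n : N | forall j, ideal_set J j -> j *: n = 0].
Proof.
split=> [j _|a u v Hu Hv j Jj]; first by rewrite scaler0.
have [_ _ _ JR] := idealP J.
by rewrite scalerDr scalerA Hu ?Hv ?addr0 //; exact: JR.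
Qed.
Definition ann_submodule : submodule N := Submodule ann_is_submodule.

(** The submodule of N killed by J; the type is a copy of it, since it carries a
    scalar multiplication by B rather than by A. *)
Definition ann_type : Type := submod ann_submodule.
HB.instance Definition _ := GRing.Zmodule.on ann_type.
HB.instance Definition _ := SubType.on ann_type.

Lemma annP (n : ann_type) j : ideal_set J j -> j *: val n = 0.
Proof. exact: (submodP n). Qed.

Definition ann_scale (b : B) (n : ann_type) : ann_type :=
  sval (cid (ring_pi_surj b)) *: (n : submod ann_submodule).

Lemma ann_scaleE l n : val (ann_scale (ring_pi J l) n) = l *: val n.
Proof.
rewrite /ann_scale; case: cid => g /= /ring_piE Jg.
by rewrite -[g](subrK l) scalerDl (annP n Jg) add0r.
Qed.

Lemma ann_valD (u v : ann_type) : val (u + v) = val u + val v.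
Proof. by []. Qed.

Fact ann_scaleA a b x : ann_scale a (ann_scale b x) = ann_scale (a * b) x.
Proof.
have [[f <-] [g <-]] := (ring_pi_surj a, ring_pi_surj b).
by apply: val_inj; rewrite -rmorphM !ann_scaleE scalerA.
Qed.
Fact ann_scale1 : left_id 1 ann_scale.
Proof.
by move=> x; apply: val_inj; rewrite -(rmorph1 (ring_pi J)) ann_scaleE scale1r.
Qed.
Fact ann_scaleDr : right_distributive ann_scale +%R.
Proof.
move=> a x y; have [f <-] := ring_pi_surj a.
by apply: val_inj; rewrite ann_scaleE !ann_valD scalerDr !ann_scaleE.
Qed.
Fact ann_scaleDl x : {morph ann_scale^~ x : a b / a + b}.
Proof.
move=> a b; have [[f <-] [g <-]] := (ring_pi_surj a, ring_pi_surj b).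
by apply: val_inj; rewrite -rmorphD ann_scaleE scalerDl ann_valD !ann_scaleE.
Qed.
HB.instance Definition _ := GRing.Zmodule_isLmodule.Build B ann_type
  ann_scaleA ann_scale1 ann_scaleDr ann_scaleDl.
Definition ann : lmodType B := ann_type.

Definition mkann n (Jn : forall j, ideal_set J j -> j *: n = 0) : ann :=
  @mksub A N ann_submodule n Jn.

Lemma annE l (n : ann) : val (ring_pi J l *: n) = l *: val n.
Proof. exact: ann_scaleE. Qed.

End Object.

Lemma ann_linear (N : lmodType A) (X : lmodType B) (f : ann N -> X) :
  (forall u v, f (u + v) = f u + f v) ->
  (forall l n, f (ring_pi J l *: n) = ring_pi J l *: f n) -> linear f.
Proof.
by move=> fD fZ b u v; have [l <-] := ring_pi_surj b; rewrite fD fZ.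
Qed.

Section Map.
Variables (N N' : lmodType A) (f : {linear N -> N'}).

Lemma ann_map_proof (n : ann N) j : ideal_set J j -> j *: f (val n) = 0.
Proof. by move=> Jj; rewrite -linearZ_LR (annP n Jj) linear0. Qed.

Lemma ann_map_linear : linear (fun n : ann N => mkann (ann_map_proof n)).
Proof.
apply: ann_linear => [u v|l n]; apply: val_inj; first by rewrite /= linearD.
rewrite [RHS]annE; have -> : l *: val (mkann (ann_map_proof n)) = f (l *: val n).
  by rewrite linearZ_LR.
by congr (f _); rewrite annE.
Qed.
Definition ann_map : {linear ann N -> ann N'} := linear_of ann_map_linear.
End Map.

Definition inflate (X : lmodType B) : lmodType A := restr (ring_pi J) X.

Lemma inflateE (X : lmodType B) l (x : inflate X) :
  l *: x = ring_pi J l *: (x : X) :> X.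
Proof. by []. Qed.

Lemma ring_pi0 j : ideal_set J j -> ring_pi J j = 0.
Proof.
by move=> Jj; rewrite -(rmorph0 (ring_pi J)); apply/ring_piE; rewrite subr0.
Qed.

Lemma inflate_ann (X : lmodType B) j (x : inflate X) : ideal_set J j -> j *: x = 0.
Proof. by move=> Jj; rewrite inflateE ring_pi0 // scale0r. Qed.

End Annihilated.

(** * Comparison of an algebra with its quotient *)

Section Reduction.
Variables (k : fieldType) (Q : quiver) (L : quiver_algebra k Q).
Local Notation kQ := (path_algebra k Q).
Local Notation sc := (qa_scalar L).
Local Notation e := (qa_idem L).
Local Notation "[ a ]" := (qa_arrow L a).
Local Notation kmod := (@kmod k Q L).

Variables (E : pred (arrow Q)) (rs : seq kQ).
Hypothesis pi_ker : forall f, qa_pi L f = 0 <-> (ideal_gen [set` rs] : set kQ) f.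
Hypothesis rs_avoid : forall f p a,
  f \in rs -> p \in msupp f -> a \in path_arrows p -> ~~ E a.
Local Notation twist := (twist pi_ker rs_avoid).

Definition null_map (M : lmodType L) : {linear kmod M -> kmod M} :=
  linear_of (@zero_linear k (kmod M) (kmod M)).

Definition cut (M : lmodType L) : lmodType L := twist (fun=> null_map M).

Lemma cut_scalar (M : lmodType L) c (m : cut M) : sc c *: m = sc c *: (m : M) :> M.
Proof. exact: twist_scalar. Qed.

Lemma cut_idem (M : lmodType L) v (m : cut M) : e v *: m = e v *: (m : M) :> M.
Proof. exact: twist_idem. Qed.

Lemma cut_arrow (M : lmodType L) a (m : cut M) :
  [a] *: m = (if E a then 0 else [a] *: (m : M)) :> M.
Proof.
by rewrite [LHS]twist_arrow /arrow_act; case: (E a); rewrite //= scaler0.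
Qed.

Lemma cut_map_linear (M N : lmodType L) (f : {linear M -> N}) :
  linear (f : cut M -> cut N).
Proof.
apply: qa_linear => [c u v|v m|a m].
- rewrite !kmodE !cut_scalar; exact: (linearP f).
- by rewrite !cut_idem linearZ_LR.
- by rewrite !cut_arrow; case: (E a); rewrite ?linear0 ?linearZ_LR.
Qed.
Definition cut_map (M N : lmodType L) (f : {linear M -> N}) :
  {linear cut M -> cut N} := linear_of (cut_map_linear f).

(* On a module where the arrows of E act by zero, eps is the projection onto the
   part killed by J, and the complementary part sees L through scalars only. If
   an arrow is removed, eps = 1; if a vertex v is removed, eps = 1 - e v. *)
Variables (J : ideal L) (eps : L).
Local Notation B := (ring_quot J).
Local Notation inflate := (@inflate L J).
Hypothesis E_J : forall a, E a -> ideal_set J [a].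
Hypothesis eps_J : ideal_set J (1 - eps).
Hypothesis eps_idem : eps * eps = eps.
Hypothesis eps_central : forall (N : lmodType L), killed E N ->
  forall l (n : N), l *: (eps *: n) = eps *: (l *: n).
Hypothesis eps_ann : forall (N : lmodType L), killed E N ->
  forall j (n : N), ideal_set J j -> j *: (eps *: n) = 0.
Hypothesis eps_compl : forall l, exists c, forall N : lmodType L,
  killed E N ->
  forall n : N, l *: ((1 - eps) *: n) = sc c *: ((1 - eps) *: n).

Lemma cut_killed (M : lmodType L) : killed E (cut M).
Proof. by move=> a m Ea; rewrite [LHS]cut_arrow Ea. Qed.

Lemma inflate_killed (X : lmodType B) : killed E (inflate X).
Proof. by move=> a x /E_J Ja; exact: inflate_ann. Qed.

Definition reduct (M : lmodType L) : lmodType B := ann J (cut M).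
Definition reduct_map (M N : lmodType L) (f : {linear M -> N}) :
  {linear reduct M -> reduct N} := ann_map J (cut_map f).

Definition to_reduct (M : lmodType L) (m : cut M) : reduct M :=
  mkann (fun j => @eps_ann (cut M) (@cut_killed M) j m).

Lemma to_reduct_linear (M : lmodType L) :
  linear (@to_reduct M : cut M -> inflate (reduct M)).
Proof.
move=> l u v; apply: val_inj.
have vD (x y : reduct M) : val (x + y) = val x + val y by [].
rewrite [in RHS]vD [in RHS]annE /= scalerDr; congr (_ + _).
by rewrite eps_central //; exact: cut_killed.
Qed.

Lemma to_reduct_val (M : lmodType L) (y : reduct M) : to_reduct (val y) = y.
Proof.
apply: val_inj => /=; apply/esym/subr0_eq.
by rewrite -{1}[val y]scale1r -scalerBl (annP y).
Qed.

(** The pullback of M and [cut P] over N, with the arrows of E acting through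
    linear lifts of their action on P, maps onto P by an L-linear map. *)
Lemma reduct_projective (P : lmodType L) : projective P -> projective (reduct P).
Proof.
move=> pP M N g f gs.
pose phi : {linear cut P -> inflate N} :=
  restr_map (ring_pi J) f \o linear_of (@to_reduct_linear P).
have Dl : linear (fun u : (inflate M * cut P)%type =>
    restr_map (ring_pi J) g u.1 - phi u.2).
  by move=> a u v; rewrite !linearP addrACA -scalerDr.
(* G0 is the pullback; E acts on it by zero. *)
pose G0 : lmodType L := kernel (linear_of Dl).
have G0e (u : G0) : g (val u).1 = f (to_reduct (val u).2).
  by apply/subr0_eq; exact: (kernelP u).
have p2l : linear (fun u : kmod G0 => (val (u : G0)).2 : kmod P).
  by move=> c u v; rewrite !kmodE /= cut_scalar.
have p2s (p : kmod P) : exists u, linear_of p2l u = p.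
  have [m gm] := gs (f (to_reduct (p : cut P))).
  have D0 : linear_of Dl (m, p) = 0 by rewrite /= gm subrr.
  by exists (mkker D0).
have [sigma sigmaK] := linear_section p2s.
pose al (a : arrow Q) : {linear kmod G0 -> kmod G0} :=
  sigma \o (linear_of (scale_kmod_linear (M := P) [a]) \o linear_of p2l).
(* G is G0 with each a in E acting as (m, p) |-> sigma (a p). *)
pose G := twist al.
have q2l : linear (fun u : G => (val (u : G0)).2 : P).
  apply: qa_linear => [c u v|v u|a u].
  - rewrite !kmodE twist_scalar; exact: p2l.
  - by rewrite twist_idem /= cut_idem.
  - rewrite twist_arrow /arrow_act; case Ea: (E a); last first.
      by rewrite /= cut_arrow Ea.
    rewrite /= cut_idem [X in e _ *: X]sigmaK /= cut_idem.
    by rewrite !scalerA qa_idem_arrow eqxx qa_arrow_idem eqxx.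
have [t tK] := projective_section (q := linear_of q2l) pP p2s.
(* Forgetting the action of E on both sides, t remains linear into G0, where the
   projection to M is linear as well. *)
have tl : linear (t : cut P -> G0).
  apply: qa_linear => [c u v|v u|a u].
  - rewrite !kmodE !cut_scalar; have := linearP t (sc c) u v.
    by rewrite twist_scalar.
  - by rewrite cut_idem linearZ_LR twist_idem.
  - rewrite cut_arrow; case Ea: (E a).
      rewrite linear0; apply/esym; apply: val_inj => /=; congr pair.
        by rewrite /= inflate_killed.
      by rewrite /= cut_killed.
    by rewrite linearZ_LR twist_arrow /arrow_act Ea.
have hl : linear (fun y : reduct P => (val (t (val y) : G0)).1 : M).
  apply: ann_linear => [u v|l u].
    by rewrite /= linearD.
  have E1 : t (l *: val u) = (l *: (t (val u) : G0)) :> G0.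
    exact: (linearZ_LR (linear_of tl)).
  by rewrite annE E1 /=; reflexivity.
exists (linear_of hl) => y.
rewrite /= G0e; congr (f _).
have -> : (val (t (val y) : G0)).2 = val y := tK (val y).
exact: to_reduct_val.
Qed.

Lemma reduct_short_exact (K P M : lmodType L) (i : {linear K -> P}) (q : {linear P -> M}) :
  short_exact i q -> short_exact (reduct_map i) (reduct_map q).
Proof.
move=> [ii qs ex]; split=> [x y|y|y].
- by move/(congr1 val) => /ii; exact: val_inj.
- have [x qx] := qs (val y); exists (to_reduct x).
  apply: val_inj; rewrite /= (linearZ_LR (cut_map q) eps x) /= qx.
  exact: (congr1 val (to_reduct_val y)).
split=> [/(congr1 val)/ex[x ix]|[x <-]]; last first.
  by apply: val_inj => /=; apply/ex; exists (val x).
have Jx j : ideal_set J j -> j *: (x : cut K) = 0.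
  move=> Jj; apply: ii; rewrite linear0.
  by rewrite [LHS](linearZ_LR (cut_map i) j x) /= ix (annP y Jj).
by exists (mkann Jx); apply: val_inj.
Qed.

(** On the part killed by J, the section comes from the projectivity of
    [reduct K]. On the complement every element of L acts by a scalar, so there
    any k-linear section will do. *)
Lemma cut_section (F K : lmodType L) (q : {linear F -> K}) :
  (forall y, exists x, q x = y) -> projective (reduct K) ->
  exists j : {linear cut K -> cut F}, forall y, q (j y) = y.
Proof.
move=> qs pK.
have [_ rs' _] := reduct_short_exact (short_exact_ker qs).
have [j' jK] := projective_section pK rs'.
have [sigma sK] := linear_section (g := restr_map (qa_scalar L) q) qs.
pose s2 (y : cut K) : cut F := (1 - eps) *: (sigma ((1 - eps) *: y) : cut F).
have compl_comm (N : lmodType L) : killed E N ->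
    forall l (n : N), (1 - eps) *: (l *: n) = l *: ((1 - eps) *: n).
  by move=> NE l n; rewrite !scalerBl scalerBr !scale1r eps_central.
have s2l : linear s2.
  move=> l u v; rewrite /s2 scalerDr (compl_comm _ (@cut_killed K)).
  have [c cE] := eps_compl l; rewrite (cE _ (@cut_killed K)).
  have -> : sigma (sc c *: ((1 - eps) *: u : cut K) + (1 - eps) *: (v : cut K)) =
     (sc c *: (sigma ((1 - eps) *: u) : cut F) : cut F) + sigma ((1 - eps) *: v) :> F.
    by rewrite !cut_scalar; exact: (linearP sigma).
  by rewrite scalerDr (cE _ (@cut_killed F)) (compl_comm _ (@cut_killed F)).
have jl : linear (fun y : cut K => val (j' (to_reduct y)) + s2 y : cut F).
  move=> l u v; rewrite s2l.
  have E1 : to_reduct (l *: u + v) = ring_pi J l *: to_reduct u + to_reduct v.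
    exact: to_reduct_linear.
  by rewrite E1 linearP ann_valD annE scalerDr addrACA.
exists (linear_of jl) => y.
rewrite -[q _]/(cut_map q _) linearD.
have -> : cut_map q (val (j' (to_reduct y))) = eps *: y.
  exact: (congr1 val (jK (to_reduct y))).
rewrite /s2 linearZ_LR; have -> : cut_map q (sigma ((1 - eps) *: y)) = (1 - eps) *: y.
  exact: sK.
rewrite scalerA mulrBl mul1r mulrBr mulr1 eps_idem subrr subr0.
by rewrite -scalerDl addrC subrK scale1r.
Qed.

Lemma shear_linear (Y K : lmodType L) (l : L) (d : {linear kmod K -> kmod Y}) :
  linear (fun u : kmod (Y * K)%type =>
    ((l *: (u : (Y * K)%type).1 + d u.2, l *: u.2) : kmod (Y * K)%type)).
Proof.
move=> c [y1 z1] [y2 z2]; congr pair => /=; last exact: scale_kmod_linear.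
have -> : d (sc c *: z1 + z2) = sc c *: (d z1 : Y) + d z2 :> Y := linearP d c z1 z2.
have -> : l *: (sc c *: y1 + y2) = sc c *: (l *: y1) + l *: y2.
  exact: scale_kmod_linear.
by rewrite addrACA -scalerDr.
Qed.

Definition shear (Y K : lmodType L) (d : arrow Q -> {linear kmod K -> kmod Y}) a :=
  linear_of (shear_linear [a] (d a)).

(** The extension of K by Y in which an arrow a of E acts on K with an extra
    component d a into Y. *)
Definition gluing (Y K : lmodType L) (d : arrow Q -> {linear kmod K -> kmod Y}) :
  lmodType L := twist (shear d).

Lemma gluing_scalar (Y K : lmodType L) d c (u : @gluing Y K d) :
  sc c *: u = (sc c *: (u : (Y * K)%type).1, sc c *: (u : (Y * K)%type).2) :> (Y * K)%type.
Proof. exact: twist_scalar. Qed.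

Lemma gluing_idem (Y K : lmodType L) d v (u : @gluing Y K d) :
  e v *: u = (e v *: (u : (Y * K)%type).1, e v *: (u : (Y * K)%type).2) :> (Y * K)%type.
Proof. exact: twist_idem. Qed.

Lemma gluing_arrow (Y K : lmodType L) d a (u : @gluing Y K d) :
  [a] *: u = ([a] *: (u : (Y * K)%type).1 +
      (if E a then e (src a) *: (d a (e (tgt a) *: (u : (Y * K)%type).2) : Y) else 0),
     [a] *: (u : (Y * K)%type).2) :> (Y * K)%type.
Proof.
rewrite [LHS]twist_arrow /arrow_act; case: (E a); last by rewrite addr0.
congr pair => /=; rewrite ?scalerDr !scalerA qa_idem_arrow eqxx qa_arrow_idem eqxx //.
Qed.

(** To lift h : kernel q -> Z along g : Y -> Z, push the extension
    kernel q -> F -> K out along h. The result is a [gluing] of Z and K, whose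
    defect is lifted linearly to Y; then F maps to the resulting [gluing] of Y
    and K, and the restriction of this map to the kernel lands in Y. *)
Lemma kernel_projective (F K : lmodType L) (q : {linear F -> K}) :
  (forall y, exists x, q x = y) -> projective F -> projective (reduct K) ->
  projective (kernel q).
Proof.
move=> qs pF pK Y Z g h gs; have [j jK] := cut_section qs pK.
have jD u v : j (u + v) = j u + j v := linearD j u v.
have jk c u : j (sc c *: (u : K)) = sc c *: (j u : F) :> F.
  by have := linearZ_LR j (sc c) u; rewrite !cut_scalar.
have je v u : j (e v *: (u : K)) = e v *: (j u : F) :> F.
  by have := linearZ_LR j (e v) u; rewrite !cut_idem.
have ja a u : ~~ E a -> j ([a] *: (u : K)) = [a] *: (j u : F) :> F.
  by move=> Ea; have := linearZ_LR j [a] u; rewrite !cut_arrow (negbTE Ea).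
(* The section j need not commute with the arrows of E; its defect a j - j a
   takes values in the kernel of q. *)
have dP a (u : K) : q ([a] *: (j u : F) - j ([a] *: u)) = 0.
  by rewrite linearB linearZ_LR !jK subrr.
have dl a : linear (fun u : kmod K => (mkker (dP a u) : kmod (kernel q))).
  move=> c u v; apply: val_inj; rewrite !kmodE /=.
  have -> : [a] *: (sc c *: (u : K) + v) = sc c *: ([a] *: (u : K)) + [a] *: (v : K).
    exact: scale_kmod_linear.
  have swap (x : F) : [a] *: (sc c *: x) = sc c *: ([a] *: x).
    by rewrite !scalerA qa_scalar_comm.
  by rewrite !jD !jk scalerDr swap scalerBr opprD addrACA.
have [tau tauK] := linear_section (g := restr_map sc g) gs.
pose hd (a : arrow Q) : {linear kmod K -> kmod Z} := restr_map sc h \o linear_of (dl a).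
pose G1 := gluing hd.
pose G2 := gluing (fun a => tau \o hd a).
have ml : linear (fun u : G2 => (g (u : (Y * K)%type).1, (u : (Y * K)%type).2) : G1).
  apply: qa_linear => [c u v|v u|a u].
  - rewrite !kmodE !gluing_scalar /=; congr pair; exact: linearP.
  - by rewrite !gluing_idem /= linearZ_LR.
  - rewrite !gluing_arrow /= linearD linearZ_LR; congr (_ + _, _).
    case: (E a); last exact: linear0.
    by rewrite linearZ_LR; congr (_ *: _); exact: tauK.
have ms (u : G1) : exists w, linear_of ml w = u.
  by case: u => z y; have [w <-] := gs z; exists (w, y).
(* u |-> (h (u - j (q u)), q u) identifies the pushout with the gluing G1. *)
have rP (u : F) : q (u - j (q u)) = 0 by rewrite linearB jK subrr.
have fl : linear (fun u : F => (h (mkker (rP u)), q u) : G1).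
  apply: qa_linear => [c u v|v u|a u].
  - rewrite !kmodE !gluing_scalar /=; congr pair; last exact: linearP.
    rewrite -linearP; congr (h _); apply: val_inj => /=.
    by rewrite linearP jD jk scalerBr opprD addrACA.
  - rewrite !gluing_idem /=; congr pair; last exact: linearZ_LR.
    rewrite -linearZ_LR; congr (h _); apply: val_inj => /=.
    by rewrite linearZ_LR je scalerBr.
  - rewrite !gluing_arrow /=; congr pair; last exact: linearZ_LR.
    case Ea: (E a); last first.
      rewrite addr0 -linearZ_LR; congr (h _); apply: val_inj => /=.
      by rewrite linearZ_LR ja ?Ea // scalerBr.
    rewrite /hd /= -[e _ *: h _]linearZ_LR -linearZ_LR -linearD; congr (h _).
    have ea (N : lmodType L) (y : N) : e (src a) *: ([a] *: y) = [a] *: y.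
      by rewrite scalerA qa_idem_arrow eqxx.
    have ae (N : lmodType L) (y : N) : [a] *: (e (tgt a) *: y) = [a] *: y.
      by rewrite scalerA qa_arrow_idem eqxx.
    apply: val_inj => /=; rewrite je !ae !scalerBr ea -je ea linearZ_LR.
    by rewrite addrA subrK.
have [t tK] := pF _ _ (linear_of ml) (linear_of fl) ms.
have t2 (u : kernel q) : (t (val u) : (Y * K)%type).2 = 0.
  by have := congr1 (fun w : G1 => (w : (Z * K)%type).2) (tK (val u)); rewrite /= kernelP.
have hl : linear (fun u : kernel q => (t (val u) : (Y * K)%type).1).
  apply: qa_linear => [c u v|v u|a u].
  - rewrite !kmodE; have := linearP t (sc c) (val u) (val v).
    by rewrite gluing_scalar => /(congr1 (fun w : (Y * K)%type => w.1)).
  - have := linearZ_LR t (e v) (val u).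
    by rewrite gluing_idem => /(congr1 (fun w : (Y * K)%type => w.1)).
  - have := linearZ_LR t [a] (val u).
    rewrite gluing_arrow => /(congr1 (fun w : (Y * K)%type => w.1)).
    rewrite t2 scaler0 (raddf0 (tau \o hd a)) scaler0 => E1; rewrite [LHS]E1.
    by case: (E a); rewrite addr0.
exists (linear_of hl) => u.
have /= := congr1 (fun w : G1 => (w : (Z * K)%type).1) (tK (val u)).
move=> ->; congr (h _); apply: val_inj => /=.
by rewrite kernelP linear0 subr0.
Qed.

Lemma pd_le_reduct n (M : lmodType L) : pd_le n M -> pd_le n (reduct M).
Proof.
elim: n M => [|n IHn] M; first exact: reduct_projective.
move=> [P [K [i [q [pP se /IHn pK]]]]].
exists (reduct P), (reduct K), (reduct_map i), (reduct_map q); split=> //.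
  exact: reduct_projective.
exact: reduct_short_exact.
Qed.

(** Syzygies commute with [reduct], up to a choice of cover; after n steps the
    reduct is projective, and one further syzygy is projective over L. *)
Lemma pd_le_of_reduct n (M : lmodType L) : pd_le n (reduct M) -> pd_le n.+1 M.
Proof.
elim: n M => [|n IHn] M pM; have [F [q [pF qs]]] := enough_projectives M;
  have se := short_exact_ker qs;
  exists F, (kernel q), (ker_incl q), q; split=> //.
  exact: kernel_projective.
by apply/IHn/(pd_le_syzygy (reduct_short_exact se)) => //; exact: reduct_projective.
Qed.

Lemma reduct_inflate (X : lmodType B) :
  exists f : {linear reduct (inflate X) -> X}, bijective f.
Proof.
have Fl : linear (id : inflate X -> cut (inflate X)).
  apply: qa_linear => [c u v|v u|a u].
  - by rewrite !kmodE cut_scalar.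
  - by rewrite cut_idem.
  - by rewrite cut_arrow; case: ifP => // Ea; rewrite inflate_killed.
have il : linear (fun y : reduct (inflate X) => val y : X).
  apply: ann_linear => // l u; rewrite annE.
  by rewrite -[LHS](linearZ_LR (linear_of Fl) l (val u)).
exists (linear_of il).
have Jx (x : X) j : ideal_set J j -> j *: (x : cut (inflate X)) = 0.
  move=> Jj; have /= <- := linearZ_LR (linear_of Fl) j x.
  exact: inflate_ann.
by exists (fun x => mkann (Jx x)) => // y; apply: val_inj.
Qed.

Lemma finitely_generated_inflate (X : lmodType B) :
  finitely_generated X -> finitely_generated (inflate X).
Proof.
move=> [n [g gP]]; exists n, g => m; have [c ->] := gP m.
have [d dE] := choice (fun i => ring_pi_surj (c i)).
by exists d; apply: eq_bigr => i _; rewrite inflateE dE.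
Qed.

Hypothesis L_span : exists (T : finType) (b : T -> L), forall l,
  exists c : T -> k, l = \sum_t sc (c t) * b t.

(** As L has a finite spanning family b over k, the products b t * g i span M
    over k, and their images span [reduct M] over k, hence over B. *)
Lemma finitely_generated_reduct (M : lmodType L) :
  finitely_generated M -> finitely_generated (reduct M).
Proof.
move=> [n [g gP]]; have [T [b bP]] := L_span.
pose gen (u : T * 'I_n) : reduct M := to_reduct (b u.1 *: g u.2).
exists #|{: T * 'I_n}|, (fun i => gen (enum_val i)) => y.
have [l yE] := gP (val y); have [c lE] := choice (fun i => bP (l i)).
exists (fun i => ring_pi J (sc (c (enum_val i).2 (enum_val i).1))).
rewrite -(reindex (fun i : 'I_#|{: T * 'I_n}| => enum_val i) (P := xpredT)
  (F := fun u : T * 'I_n => ring_pi J (sc (c u.2 u.1)) *: gen u)) /=; last first.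
  by apply: onW_bij; exact: enum_val_bij.
rewrite -(to_reduct_val y) yE.
have -> : \sum_i l i *: g i =
    \sum_(u : T * 'I_n) sc (c u.2 u.1) *: (b u.1 *: g u.2 : M) :> M.
  under eq_bigr => i _ do rewrite lE scaler_suml.
  rewrite exchange_big pair_big /=; apply: eq_bigr => u _.
  by rewrite scalerA.
rewrite -[LHS]/(linear_of (@to_reduct_linear M) _) (linear_sum (linear_of (@to_reduct_linear M))).
apply: eq_bigr => u _.
by rewrite -cut_scalar linearZ_LR.
Qed.

Local Open Scope ereal_scope.

Lemma findim_quotient_le : findim B <= findim L.
Proof.
apply: findim_lub => X fX /pd_finite[n pX _].
have [f fb] := reduct_inflate X; have [g _ gb] := bijective_linear_inv fb.
have pI : pd_le n.+1 (inflate X) by apply: pd_le_of_reduct; exact: pd_le_iso gb pX.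
have [m [pm _ E1]] := pd_attained pI.
have pm' : pd_le m X by apply: pd_le_iso fb _; exact: pd_le_reduct.
have [m' [_ le_m'm E2]] := pd_attained pm'.
apply: le_trans (findim_ub (finitely_generated_inflate fX) pI).
by rewrite E1 E2 lee_fin lez_nat.
Qed.

Lemma findim_le_quotient : findim L <= findim B + 1%:E.
Proof.
apply: findim_lub => M fM /pd_finite[n /pd_le_reduct pR _].
have [m [pm _ E1]] := pd_attained pR.
have [m' [_ le_m'm ->]] := pd_attained (pd_le_of_reduct pm).
apply: (@le_trans _ _ (m%:Z%:E + 1%:E)).
  by rewrite -EFinD lee_fin -PoszD lez_nat addn1.
rewrite -E1 leeD2r //; apply: findim_ub pm; exact: finitely_generated_reduct.
Qed.
End Reduction.

(** * Paths through an arrow or a vertex *)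

Section PathFacts.
Variables (k : fieldType) (Q : quiver).

Lemma path_cut (p : qpath Q) s t : path_arrows p = s ++ t ->
  exists q1 q2 : qpath Q, [/\ path_arrows q1 = s, path_src q1 = path_src p,
     path_arrows q2 = t, path_src q2 = path_tgt q1 &
     path_elt k p = path_elt k q1 * path_elt k q2].
Proof.
move=> E; have wp : walk (path_src p) (s ++ t) by rewrite -E; case: p {E}.
have := wp; rewrite walk_cat => /andP[ws wt].
pose q1 := @QPath Q (path_src p, s) ws.
pose q2 := @QPath Q (walk_end (path_src p) s, t) wt.
exists q1, q2; split=> //; rewrite [RHS]path_mul_elt /path_elt_comp.
by have -> : path_comp q1 q2 = Some p by apply/path_compP.
Qed.

Lemma path_elt_src (p : qpath Q) :
  path_elt k p = path_elt k (trivial_path (path_src p)) * path_elt k p.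
Proof.
rewrite [RHS]path_mul_elt /path_elt_comp.
by have -> : path_comp (trivial_path (path_src p)) p = Some p by apply/path_compP.
Qed.

Lemma arrow_pathE (p : qpath Q) a : path_arrows p = [:: a] -> p = arrow_path a.
Proof.
case: p => -[u s] /= ws E; rewrite /path_arrows /= in E; rewrite E in ws *.
by apply: val_inj => /=; have /andP[/eqP <-] := ws.
Qed.

Lemma factors_through_arrow (p : qpath Q) a :
  a \in path_arrows p -> factors_through k (inr a) p.
Proof.
rewrite /factors_through; case/splitPr E : _ / => [s t].
have [q1 [q2 [_ _ E2 _ ->]]] := path_cut E.
have [q3 [q4 [/arrow_pathE E3 _ _ _ ->]]] := path_cut (s := [:: a]) E2.
by exists q1, q4; rewrite /= -mulrA E3.
Qed.

Lemma factors_through_src (p : qpath Q) a :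
  a \in path_arrows p -> factors_through k (inl (src a)) p.
Proof.
rewrite /factors_through; case/splitPr E : _ / => [s t].
have [q1 [q2 [_ _ E2 E3 ->]]] := path_cut E.
have sa : path_src q2 = src a.
  have : walk (path_src q2) (path_arrows q2) by case: q2 {E2 E3}.
  by rewrite E2 => /andP[/eqP].
by exists q1, q2; rewrite {1}(path_elt_src q2) sa mulrA.
Qed.

Lemma factors_through_tgt (p : qpath Q) a :
  a \in path_arrows p -> factors_through k (inl (tgt a)) p.
Proof.
rewrite /factors_through; case/splitPr E : _ / => [s t]; rewrite -cat_rcons in E.
have [q1 [q2 [E1 _ E2 E3 ->]]] := path_cut E.
exists q1, q2; rewrite {1}(path_elt_src q2) E3 mulrA.
by rewrite /path_tgt E1 /walk_end map_rcons last_rcons.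
Qed.

Lemma path_elt_ideal_exp m (p : qpath Q) : (m <= size (path_arrows p))%N ->
  ideal_set (ideal_exp (arrow_ideal k Q) m) (path_elt k p).
Proof.
elim: m p => [|m IHm] p //=.
case E : (path_arrows p) => [|a s] //= lt_ms.
have [q1 [q2 [/arrow_pathE E1 _ E2 _ ->]]] := path_cut (s := [:: a]) E.
exists 1%N, (fun=> path_elt k q1), (fun=> path_elt k q2); split=> [_|_|].
- by rewrite E1 => J [_ +]; apply; exists a.
- by apply: IHm; rewrite E2.
- by rewrite big_ord_recl big_ord0 addr0.
Qed.

End PathFacts.

Section Spanning.
Variables (k : fieldType) (Q : quiver) (L : quiver_algebra k Q).
Local Notation sc := (qa_scalar L).

(** The spanning family runs over all sequences of fewer than m arrows with a
    starting vertex; those that are not paths are sent to 0. *)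
Lemma qa_finite_span m :
  (forall p, (m <= size (path_arrows p))%N -> qa_pi L (path_elt k p) = 0) ->
  exists (T : finType) (b : T -> L), forall l,
    exists c : T -> k, l = \sum_t sc (c t) * b t.
Proof.
move=> long; pose T := (vertex Q * {i : 'I_m & i.-tuple (arrow Q)})%type.
pose b (t : T) : L :=
  if insub (t.1, val (tagged t.2)) is Some p then qa_pi L (path_elt k (p : qpath Q))
  else 0.
have span0 : exists c : T -> k, 0 = \sum_t sc (c t) * b t.
  by exists (fun=> 0); rewrite big1 // => t _; rewrite rmorph0 mul0r.
exists T, b => l; have [f <-] := qa_surj l.
elim/path_algebra_ind: f => [|f g [c E1] [d E2]|a f [c E1]|p].
- by rewrite rmorph0.
- exists (fun t => c t + d t); rewrite rmorphD E1 E2 -big_split.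
  by apply: eq_bigr => t _ /=; rewrite rmorphD mulrDl.
- exists (fun t => a * c t); rewrite -qa_scalar_pi E1 mulr_sumr.
  by apply: eq_bigr => t _; rewrite rmorphM mulrA.
have [lt_pm|le_mp] := ltnP (size (path_arrows p)) m; last by rewrite long.
pose t0 : T := (path_src p, Tagged (fun i : 'I_m => i.-tuple (arrow Q))
  (in_tuple (path_arrows p) : (Ordinal lt_pm).-tuple (arrow Q))).
have b0 : b t0 = qa_pi L (path_elt k p).
  by rewrite /b /= (_ : (_, _) = val p) ?valK //; case: (p) => -[].
exists (fun t => (t == t0)%:R); rewrite (bigD1 t0) //= eqxx rmorph1 mul1r b0.
rewrite big1 ?addr0 // => t /negbTE ->.
by rewrite rmorph0 mul0r.
Qed.

End Spanning.

(** * Removing an arrow, removing a vertex *)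

Section Cases.
Variables (k : fieldType) (Q : quiver) (L : quiver_algebra k Q).
Local Notation kQ := (path_algebra k Q).
Local Notation sc := (qa_scalar L).
Local Notation e := (qa_idem L).
Local Notation "[ a ]" := (qa_arrow L a).

Variable rs : seq kQ.
Hypothesis pi_ker : forall f, qa_pi L f = 0 <-> (ideal_gen [set` rs] : set kQ) f.

Lemma ideal_gen_ind (R : pzRingType) (S J : set R) : two_sided_ideal J ->
  S `<=` J -> forall r, ideal_set (ideal_gen S) r -> J r.
Proof. by move=> JI SJ r; apply. Qed.

Lemma ideal_gen_mem (R : pzRingType) (S : set R) r : S r -> ideal_set (ideal_gen S) r.
Proof. by move=> Sr J [_]; apply. Qed.

Hypothesis L_span : exists (T : finType) (b : T -> L), forall l,
  exists c : T -> k, l = \sum_t sc (c t) * b t.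

Local Open Scope ereal_scope.

Lemma findim_arrow (a : arrow Q) :
  (forall f p, f \in rs -> p \in msupp f -> ~ factors_through k (inr a) p) ->
  let J := ideal_gen [set [a]%R] in
  findim L <= findim (ring_quot J) + 1%:E /\ findim (ring_quot J) <= findim L.
Proof.
move=> avoid J; pose E b := b == a.
have Ja : ideal_set J [a]%R by apply: ideal_gen_mem.
have av f p b : f \in rs -> p \in msupp f -> b \in path_arrows p -> ~~ E b.
  move=> fr pf bp; apply/eqP => Eb; rewrite Eb in bp.
  exact: (avoid _ _ fr pf) (factors_through_arrow k bp).
have E_J b : E b -> ideal_set J [b]%R by move/eqP->.
have [J0 _ _ _] := idealP J.
have eps_J : ideal_set J (1 - 1)%R by rewrite subrr.
have eps_ann (N : lmodType L) : killed E N ->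
    forall j (n : N), ideal_set J j -> (j *: (1 *: n) = 0)%R.
  move=> NE j n; rewrite scale1r.
  suff H : J `<=` [set i | forall n : N, (i *: n = 0)%R] by move=> /H.
  apply: ideal_gen_ind => [|_ -> n']; last exact: NE (eqxx a).
  split=> [n'|x y Hx Hy n'|x y Hy n'|x y Hy n']; rewrite ?scale0r //.
  - by rewrite scalerDl Hx Hy addr0.
  - by rewrite -scalerA Hy scaler0.
  - by rewrite -scalerA Hy.
have eps_compl l : exists c, forall N : lmodType L,
    killed E N ->
    forall n : N, (l *: ((1 - 1) *: n) = sc c *: ((1 - 1) *: n))%R.
  by exists 0%R => N _ n; rewrite subrr scale0r !scaler0.
have eps_central (N : lmodType L) : killed E N ->
    forall l (n : N), (l *: (1 *: n) = 1 *: (l *: n))%R.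
  by move=> _ l n; rewrite !scale1r.
have eps_idem : (1 * 1 = 1 :> L)%R by rewrite mulr1.
split.
- exact: (findim_le_quotient pi_ker av E_J eps_J eps_idem eps_central eps_ann eps_compl).
- exact: (findim_quotient_le pi_ker av E_J eps_J eps_idem eps_central eps_ann eps_compl).
Qed.

(** Here E is the set of arrows adjacent to v. Once they act by zero, e v is
    central and splits off a part on which all other paths vanish. *)
Lemma findim_vertex (v : vertex Q) :
  (forall f p, f \in rs -> p \in msupp f -> ~ factors_through k (inl v) p) ->
  let J := ideal_gen [set e v] in
  findim L <= findim (ring_quot J) + 1%:E /\ findim (ring_quot J) <= findim L.
Proof.
move=> avoid J; pose E a := (src a == v) || (tgt a == v).
have Jv : ideal_set J (e v) by apply: ideal_gen_mem.
have av f p a : f \in rs -> p \in msupp f -> a \in path_arrows p -> ~~ E a.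
  move=> fr pf ap; apply/negP => /orP[] /eqP Ea; apply: (avoid _ _ fr pf);
    rewrite -Ea; [exact: factors_through_src|exact: factors_through_tgt].
have [_ _ JL JR] := idealP J.
have E_J a : E a -> ideal_set J [a]%R.
  case/orP=> /eqP Ea.
    by have := JR [a]%R _ Jv; rewrite qa_idem_arrow Ea eqxx.
  by have := JL [a]%R _ Jv; rewrite qa_arrow_idem Ea eqxx.
have evv : (e v * e v = e v)%R by rewrite qa_idemM eqxx.
pose eps : L := (1 - e v)%R.
have epsC : (1 - eps = e v)%R by rewrite /eps opprB addrC subrK.
have eps_J : ideal_set J (1 - eps)%R by rewrite epsC.
have ev_eps : (e v * eps = 0)%R by rewrite mulrBr mulr1 evv subrr.
have eps_idem : (eps * eps = eps)%R by rewrite {1}/eps mulrBl mul1r ev_eps subr0.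
have left_kill (N : lmodType L) : killed E N ->
    forall a (n : N), ([a] *: (e v *: n) = 0)%R.
  move=> NE a n; rewrite scalerA qa_arrow_idem; case: eqVneq => [va|_].
    by rewrite NE // /E va eqxx orbT.
  by rewrite scale0r.
have right_kill (N : lmodType L) : killed E N ->
    forall a (n : N), (e v *: ([a] *: n) = 0)%R.
  move=> NE a n; rewrite scalerA qa_idem_arrow; case: eqVneq => [va|_].
    by rewrite NE // /E va eqxx.
  by rewrite scale0r.
have ev_central (N : lmodType L) : killed E N ->
    forall l (n : N), (l *: (e v *: n) = e v *: (l *: n))%R.
  move=> NE; elim/qa_ind => [|l l' H H'|c l H|u|a l H] n.
  - by rewrite !scale0r scaler0.
  - by rewrite !scalerDl scalerDr H H'.
  - by rewrite -!scalerA H !scalerA qa_scalar_comm.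
  - rewrite !scalerA !qa_idemM eq_sym; case: eqVneq => [->|] //.
  - by rewrite -!scalerA H left_kill // right_kill.
have eps_central (N : lmodType L) : killed E N ->
    forall l (n : N), (l *: (eps *: n) = eps *: (l *: n))%R.
  by move=> NE l n; rewrite !scalerBl scalerBr !scale1r ev_central.
have eps_ann (N : lmodType L) : killed E N ->
    forall j (n : N), ideal_set J j -> (j *: (eps *: n) = 0)%R.
  move=> NE j n.
  suff H : J `<=` [set i | forall n : N, (i *: (eps *: n) = 0)%R] by move=> /H.
  apply: ideal_gen_ind => [|_ -> n']; last by rewrite scalerA ev_eps scale0r.
  split=> [n'|x y Hx Hy n'|x y Hy n'|x y Hy n']; rewrite ?scale0r //.
  - by rewrite scalerDl Hx Hy addr0.
  - by rewrite -scalerA Hy scaler0.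
  - by rewrite -scalerA eps_central // Hy.
have eps_compl l : exists c, forall N : lmodType L,
    killed E N ->
    forall n : N, (l *: ((1 - eps) *: n) = sc c *: ((1 - eps) *: n))%R.
  rewrite epsC; elim/qa_ind: l => [|l l' [c H] [c' H']|d l [c H]|u|a l [c H]].
  - by exists 0%R => N _ n; rewrite rmorph0.
  - by exists (c + c')%R => N NE n; rewrite rmorphD !scalerDl H ?H'.
  - by exists (d * c)%R => N NE n; rewrite rmorphM -!scalerA H.
  - exists (u == v)%:R%R => N _ n; rewrite scalerA qa_idemM.
    by case: eqVneq => [->|_]; rewrite ?rmorph1 ?scale1r // rmorph0 !scale0r.
  - exists 0%R => N NE n; rewrite rmorph0 scale0r -scalerA H //.
    by rewrite scalerA -qa_scalar_comm -scalerA left_kill // scaler0.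
split.
- exact: (findim_le_quotient pi_ker av E_J eps_J eps_idem eps_central eps_ann eps_compl).
- exact: (findim_quotient_le pi_ker av E_J eps_J eps_idem eps_central eps_ann eps_compl).
Qed.

End Cases.

(** * The quotient of the path algebra *)

Section QuotientPresentation.
Variables (k : fieldType) (Q : quiver) (I : ideal (path_algebra k Q)).
Local Notation kQ := (path_algebra k Q).

Definition quot_scalar (c : k) : ring_quot I := ring_pi I (c *: (1 : kQ)).

Fact quot_scalar_zmod_morphism : zmod_morphism quot_scalar.
Proof. by move=> a b; rewrite /quot_scalar scalerBl rmorphB. Qed.
HB.instance Definition _ :=
  GRing.isZmodMorphism.Build k (ring_quot I) quot_scalar quot_scalar_zmod_morphism.

Fact quot_scalar_monoid_morphism : monoid_morphism quot_scalar.
Proof.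
split=> [|a b]; first by rewrite /quot_scalar scale1r rmorph1.
by rewrite /quot_scalar -rmorphM -path_algebra_scaleAl mul1r scalerA.
Qed.
HB.instance Definition _ :=
  GRing.isMonoidMorphism.Build k (ring_quot I) quot_scalar quot_scalar_monoid_morphism.

Definition quotient_algebra : quiver_algebra k Q :=
  @QuiverAlgebra k Q (ring_quot I) (ring_pi I) quot_scalar
    (fun v => ring_pi I (path_elt k (trivial_path v)))
    (fun a => ring_pi I (path_elt k (arrow_path a)))
    (@ring_pi_surj _ I) (fun=> erefl) (fun=> erefl) (fun=> erefl).

Lemma quotient_pi_ker f : qa_pi quotient_algebra f = 0 <-> ideal_set I f.
Proof. by rewrite -(rmorph0 (ring_pi I)) -[X in ideal_set I X]subr0; exact: ring_piE. Qed.

Lemma quotient_span : admissible I ->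
  exists (T : finType) (b : T -> quotient_algebra), forall l,
    exists c : T -> k, l = \sum_t qa_scalar quotient_algebra (c t) * b t.
Proof.
move=> [[m _ mI] _]; apply: (@qa_finite_span k Q quotient_algebra m) => p le_mp.
by apply/quotient_pi_ker/mI; exact: path_elt_ideal_exp.
Qed.

End QuotientPresentation.

Local Open Scope ereal_scope.

Theorem proposition1p3 (k : fieldType) (Q : quiver) (I : ideal (path_algebra k Q))
    (x : vertex Q + arrow Q) :
  admissible I ->
  generated_by_relations_not_involving x I ->
  let Lambda := ring_quot I in
  let J := ideal_gen [set ring_pi I (quiver_elt k x)] in
  findim Lambda <= 2%:E * findim (ring_quot J) + 3%:E /\
  2%:E * findim (ring_quot J) + 3%:E <= 2%:E * findim Lambda + 3%:E.
Proof.
move=> adm [rs [_ avoid I_gen]] Lambda J.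
have pi_ker f : qa_pi (quotient_algebra I) f = 0%R <->
    (ideal_gen [set` rs] : set (path_algebra k Q)) f.
  by rewrite -I_gen; exact: quotient_pi_ker.
suff [le1 le2] : findim Lambda <= findim (ring_quot J) + 1%:E /\
    findim (ring_quot J) <= findim Lambda.
  have d0 := findim_ge0 (ring_quot J).
  split; last by apply: leeD2r; apply: lee_wpmul2l; rewrite ?lee_fin.
  apply: le_trans le1 _; move: d0; case: (findim (ring_quot J)) => [d| |] //.
    by rewrite -EFinM -!EFinD !lee_fin; lia.
have span := quotient_span adm.
case: x @J avoid => [v|a] J avoid.
  exact: (@findim_vertex k Q (quotient_algebra I) rs pi_ker span v avoid).
exact: (@findim_arrow k Q (quotient_algebra I) rs pi_ker span a avoid).
Qed.
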